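(* Let $T := S \cap \overline{\mathcal{O}}_{[4,2]}$ be the scheme-theoretic intersection, inside $\mathfrak{sp}_6$, of the transverse slice $$S = \left\{ \begin{pmatrix} Z_1 & I \\ Z_2 & Z_1 \end{pmatrix} \;\middle|\; Z_1, Z_2 \in M_3(\mathbb{C}),\ Z_1 + Z_1^T = 0,\ Z_2 = Z_2^T \right\}$$ to the nilpotent orbit $\mathcal{O}_{[2,2,2]}$ at $x_0 = \begin{pmatrix} 0 & I \\ 0 & 0\end{pmatrix}$ with the nilpotent orbit closure $\overline{\mathcal{O}}_{[4,2]}$. Then $T$ is isomorphic, as an algebraic variety, to the wreath product $X := \operatorname{Sym}^2(\mathbb{C}^2/\{\pm 1\})$.
   Context: Everything is over $\mathbb{C}$. $\mathfrak{sp}_6$ is the symplectic Lie algebra of the form $\omega = \sum_{i=1}^3 e_i^* \wedge e_{i+3}^*$ on $\mathbb{C}^6$ with basis $e_1,\dots,e_6$; $I$ is the $3\times 3$ identity matrix. $\mathcal{O}_{[2,2,2]}$ and $\mathcal{O}_{[4,2]}$ denote the $\operatorname{Sp}_6$-orbits of nilpotent matrices in $\mathfrak{sp}_6$ with Jordan blocks of sizes $(2,2,2)$ and $(4,2)$ respectively; the closure $\overline{\mathcal{O}}_{[4,2]}$ carries its reduced scheme structure and as a set equals $\{A \in \mathfrak{sp}_6 \mid A^4 = 0\}$. With $y_0 = \begin{pmatrix} 0 & 0 \\ I & 0\end{pmatrix}$, one has $S = x_0 + \mathfrak{g}^{y_0}$, where $\mathfrak{g} = \mathfrak{sp}_6$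 and $\mathfrak{g}^{y_0} = \{z \in \mathfrak{g} \mid [z,y_0]=0\}$. $X = \operatorname{Sym}^2(\mathbb{C}^2/\{\pm 1\})$ is the quotient $\mathbb{C}^4/H$, where $H \subset \operatorname{Sp}(4)$ is generated by $\sigma(x_1,x_2,y_1,y_2) = (y_1,y_2,x_1,x_2)$ and $\tau(x_1,x_2,y_1,y_2) = (-x_1,-x_2,y_1,y_2)$. *)

(* Defs.v *)
From HB Require Import structures.
From mathcomp Require Import all_boot all_order all_algebra.
From mathcomp Require Import generic_quotient ring_quotient.
From mathcomp Require Import boolp classical_sets reals.
From mathcomp Require Import complex mpoly.

Set Implicit Arguments.
Unset Strict Implicit.
Unset Printing Implicit Defensive.

Import GRing.Theory.
Local Open Scope ring_scope.
Local Open Scope quotient_scope.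
Local Open Scope classical_set_scope.

(* An ideal is not required to be proper, unlike [idealr] of ring_quotient:
   the empty scheme is allowed. *)
Record ideal (A : comNzRingType) := Ideal {
  ideal_set :> A -> Prop;
  ideal0 : ideal_set 0;
  idealD : forall a b, ideal_set a -> ideal_set b -> ideal_set (a + b);
  idealM : forall a b, ideal_set b -> ideal_set (a * b) }.

Section IdealSum.
Variables (A : comNzRingType) (I J : ideal A).

Let sum_set : set A := [set c | exists2 a, I a & exists2 b, J b & c = a + b].

Lemma ideal_sum0 : sum_set 0.
Proof.
by exists 0; [exact: ideal0 | exists 0; [exact: ideal0 | rewrite addr0]].
Qed.

Lemma ideal_sumD a b : sum_set a -> sum_set b -> sum_set (a + b).
Proof.
move=> [a1 Ia1 [a2 Ja2 ->]] [b1 Ib1 [b2 Jb2 ->]].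
exists (a1 + b1); first exact: idealD.
by exists (a2 + b2); [exact: idealD | rewrite addrACA].
Qed.

Lemma ideal_sumM a b : sum_set b -> sum_set (a * b).
Proof.
move=> [b1 Ib1 [b2 Jb2 ->]].
exists (a * b1); first exact: idealM.
by exists (a * b2); [exact: idealM | rewrite mulrDr].
Qed.

Definition ideal_sum : ideal A := Ideal ideal_sum0 ideal_sumD ideal_sumM.
End IdealSum.

(* The quotient algebra A / I, for A a commutative F-algebra.  It may be the
   zero ring, so it only carries the structures of commutative [pzRingType] and
   of F-module, not that of [algType]. *)
Section IdealQuotient.
Variables (F : comNzRingType) (A : comAlgType F) (I : ideal A).

Definition in_ideal : {pred A} := fun a => `[< I a >].

Lemma in_idealE a : (a \in in_ideal) = `[< I a >].
Proof. by []. Qed.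

Lemma in_ideal_zmod : zmod_closed in_ideal.
Proof.
split=> [|a b]; rewrite !in_idealE; first exact/asboolP/ideal0.
move=> /asboolP Ia /asboolP Ib; apply/asboolP.
by rewrite -mulN1r; apply: idealD => //; apply: idealM.
Qed.

HB.instance Definition _ := GRing.isZmodClosed.Build A in_ideal in_ideal_zmod.

Lemma in_idealM a b : b \in in_ideal -> a * b \in in_ideal.
Proof. by rewrite !in_idealE => /asboolP Ib; apply/asboolP/idealM. Qed.

Definition quot_alg := Quotient.quot in_ideal.
HB.instance Definition _ := GRing.Zmodule.on quot_alg.

Definition quot_pi (a : A) : quot_alg := \pi_(Quotient.quot in_ideal) a.

Lemma quot_piP a b : quot_pi a = quot_pi b <-> I (a - b).
Proof.
rewrite /quot_pi; split=> [/eqP | Iab].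
  by rewrite -Quotient.idealrBE => /asboolP.
by apply/eqP; rewrite -Quotient.idealrBE; apply/asboolP.
Qed.

Lemma quot_piK (u : quot_alg) : quot_pi (repr u) = u.
Proof. exact: reprK. Qed.

Lemma quot_piD a b : quot_pi (a + b) = quot_pi a + quot_pi b.
Proof. exact: Quotient.pi_add. Qed.

Definition quot_one : quot_alg := quot_pi 1.
Definition quot_mul (u v : quot_alg) : quot_alg := quot_pi (repr u * repr v).
Definition quot_scale (c : F) (u : quot_alg) : quot_alg := quot_pi (c *: repr u).

Lemma quot_repr a : I (repr (quot_pi a) - a).
Proof. by apply/quot_piP; rewrite quot_piK. Qed.

Lemma quot_piM a b : quot_pi (a * b) = quot_mul (quot_pi a) (quot_pi b).
Proof.
apply/esym/quot_piP; set a' := repr _; set b' := repr _.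
rewrite [X in I X](_ : _ = b' * (a' - a) + a * (b' - b)).
  by apply: idealD; apply: idealM; apply: quot_repr.
by rewrite !mulrBr addrA (mulrC b') (mulrC b') subrK.
Qed.

Lemma quot_piZ c a : quot_pi (c *: a) = quot_scale c (quot_pi a).
Proof.
apply/esym/quot_piP; rewrite -scalerBr -[X in c *: X]mul1r scalerAl.
by apply: idealM; apply: quot_repr.
Qed.

Lemma quot_mulA : associative quot_mul.
Proof.
move=> u v w; rewrite -[u]quot_piK -[v]quot_piK -[w]quot_piK.
by rewrite -!quot_piM mulrA.
Qed.

Lemma quot_mulC : commutative quot_mul.
Proof. by move=> u v; rewrite /quot_mul mulrC. Qed.

Lemma quot_mul1 : left_id quot_one quot_mul.
Proof. by move=> u; rewrite -[u]quot_piK -quot_piM mul1r. Qed.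

Lemma quot_mulDl : left_distributive quot_mul +%R.
Proof.
move=> u v w; rewrite -[u]quot_piK -[v]quot_piK -[w]quot_piK.
by rewrite -quot_piD -!quot_piM -quot_piD mulrDl.
Qed.

HB.instance Definition _ := GRing.Zmodule_isComPzRing.Build quot_alg
  quot_mulA quot_mulC quot_mul1 quot_mulDl.

Lemma quot_scaleA c d u : quot_scale c (quot_scale d u) = quot_scale (c * d) u.
Proof. by rewrite -[u]quot_piK -!quot_piZ scalerA. Qed.

Lemma quot_scale1 : left_id 1 quot_scale.
Proof. by move=> u; rewrite -[u]quot_piK -quot_piZ scale1r. Qed.

Lemma quot_scaleDr : right_distributive quot_scale +%R.
Proof.
move=> c u v; rewrite -[u]quot_piK -[v]quot_piK.
by rewrite -quot_piD -!quot_piZ -quot_piD scalerDr.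
Qed.

Lemma quot_scaleDl u : {morph quot_scale^~ u : c d / c + d}.
Proof.
by move=> c d; rewrite -[u]quot_piK -!quot_piZ -quot_piD scalerDl.
Qed.

HB.instance Definition _ := GRing.Zmodule_isLmodule.Build F quot_alg
  quot_scaleA quot_scale1 quot_scaleDr quot_scaleDl.

End IdealQuotient.

(* Closed subschemes of the affine space A^n over F, whose points are the row
   vectors 'rV[F]_n, are given by ideals of {mpoly F[n]}. *)
Section AffineSpace.
Variables (F : comNzRingType) (n : nat).
Implicit Types (Y : set 'rV[F]_n) (p : {mpoly F[n]}).

Definition peval p (v : 'rV[F]_n) : F := p.@[v 0].

Section VanishingIdeal.
Variable Y : set 'rV[F]_n.

Let vanishing_set : set {mpoly F[n]} := [set p | forall v, Y v -> peval p v = 0].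

Lemma vanishing0 : vanishing_set 0.
Proof. by move=> v _; rewrite /peval meval0. Qed.

Lemma vanishingD p q : vanishing_set p -> vanishing_set q -> vanishing_set (p + q).
Proof.
move=> p0 q0 v Yv.
by rewrite /peval mevalD [X in X + _]p0 // [X in _ + X]q0 // addr0.
Qed.

Lemma vanishingM p q : vanishing_set q -> vanishing_set (p * q).
Proof. by move=> q0 v Yv; rewrite /peval mevalM [X in _ * X]q0 ?mulr0. Qed.

(* For Y closed, this is the ideal of Y with its reduced structure; then
   [ideal_sum] of two such ideals is the scheme-theoretic intersection. *)
Definition vanishing_ideal : ideal {mpoly F[n]} :=
  Ideal vanishing0 vanishingD vanishingM.
End VanishingIdeal.

Definition zero_locus (I : ideal {mpoly F[n]}) : set 'rV[F]_n :=
  [set v | forall p, I p -> peval p v = 0].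

Definition zariski_closure Y : set 'rV[F]_n := zero_locus (vanishing_ideal Y).

End AffineSpace.

(* Quotient of A^n by a set H of matrices acting by v |-> v *m h: the algebra
   of H-invariant polynomials. Over an infinite field, invariance as a polynomial
   and as a polynomial function agree. *)
Section Invariants.
Variables (F : comNzRingType) (n : nat) (H : set 'M[F]_n).

Definition invariant : {pred {mpoly F[n]}} :=
  fun p => `[< forall h, H h -> forall v, peval p (v *m h) = peval p v >].

Lemma invariantP p :
  reflect (forall h, H h -> forall v, peval p (v *m h) = peval p v)
          (p \in invariant).
Proof. exact: asboolP. Qed.

Lemma invariant_subalg : subalg_closed invariant.
Proof.
split=> [|c p q /invariantP ip /invariantP iq|p q /invariantP ip /invariantP iq];
  apply/invariantP => h Hh v; rewrite /peval.
- by rewrite !meval1.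
- by rewrite !mevalD !mevalZ [X in _ * X]ip // [X in _ + X]iq.
- by rewrite !mevalM [X in X * _]ip // [X in _ * X]iq.
Qed.

HB.instance Definition _ :=
  GRing.isSubalgClosed.Build F {mpoly F[n]} invariant invariant_subalg.

Record invariant_alg := InvariantAlg {
  invariant_val :> {mpoly F[n]};
  invariant_valP : invariant_val \in invariant }.

HB.instance Definition _ := [isSub for invariant_val].
HB.instance Definition _ := [Choice of invariant_alg by <:].
HB.instance Definition _ := [SubChoice_isSubComNzRing of invariant_alg by <:].
HB.instance Definition _ := [SubNmodule_isSubLSemiModule of invariant_alg by <:].
HB.instance Definition _ := [SubNzRing_SubLmodule_isSubLalgebra of invariant_alg by <:].
HB.instance Definition _ := [SubLalgebra_isSubAlgebra of invariant_alg by <:].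

End Invariants.

Section MatrixGroups.
Variables (F : comUnitRingType) (n : nat).

Inductive generated_group (gens : set 'M[F]_n) : set 'M[F]_n :=
| Gen_in g of gens g : generated_group gens g
| Gen_1 : generated_group gens 1%:M
| Gen_mul g h of generated_group gens g & generated_group gens h :
    generated_group gens (g *m h)
| Gen_inv g of generated_group gens g : generated_group gens (invmx g).

(* The Gram matrix of sum_i e_i^* /\ e_(i+n)^*. *)
Definition omega : 'M[F]_(n + n) := block_mx 0 1%:M (- 1%:M) 0.

Definition Sp : set 'M[F]_(n + n) := [set g | g^T *m omega *m g = omega].

Definition sp : set 'M[F]_(n + n) := [set A | A^T *m omega + omega *m A = 0].

Definition Sp_orbit (x : 'M[F]_(n + n)) : set 'M[F]_(n + n) :=
  [set g *m x *m invmx g | g in Sp].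

End MatrixGroups.
Arguments omega {F n}.
Arguments Sp {F n}.
Arguments sp {F n}.

Section JordanType.
Variable F : comUnitRingType.

Definition jordan_block k : 'M[F]_k := \matrix_(i, j) (i.+1 == j)%:R.

Fixpoint jordan_mx (s : seq nat) : 'M[F]_(sumn s) :=
  if s is k :: s' then block_mx (jordan_block k) 0 0 (jordan_mx s') else 0.

(* A is nilpotent with Jordan blocks of sizes s; the rectangular matrices P and
   Q = P^-1 avoid a cast along [sumn s = n]. *)
Definition nilpotent_type n (s : seq nat) (A : 'M[F]_n) : Prop :=
  exists (P : 'M[F]_(n, sumn s)) (Q : 'M[F]_(sumn s, n)),
    [/\ P *m Q = 1%:M, Q *m P = 1%:M & A = P *m jordan_mx s *m Q].

End JordanType.

(* Closed subschemes of the linear subspace [sp] are treated as subschemes of the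
   space of all matrices, identified with an affine space by [mxvec]; their
   scheme-theoretic intersections are the same in both ambient spaces. *)
Section Slice.
Variable F : comUnitRingType.

Definition slice : set 'M[F]_(3 + 3) :=
  [set A | exists Z1 Z2 : 'M[F]_3,
    [/\ Z1 + Z1^T = 0, Z2 = Z2^T & A = block_mx Z1 1%:M Z2 Z1]].

Let x0 : 'M[F]_(3 + 3) := block_mx 0 1%:M 0 0.
Let y0 : 'M[F]_(3 + 3) := block_mx 0 0 1%:M 0.

Lemma sp_blockE (A B C D : 'M[F]_3) :
  sp (block_mx A B C D) <-> [/\ B^T = B, C^T = C & D = - A^T].
Proof.
rewrite /sp /omega /= tr_block_mx !mulmx_block add_block_mx.
rewrite !mulmx0 !mul0mx !mulmx1 !mul1mx !mulmxN !mulNmx !mulmx1 !mul1mx.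
rewrite !addr0 !add0r -[X in _ = X](@block_mx0 F 3 3 3 3).
split=> [/eq_block_mx[eC eD _ eB]|[-> -> ->]].
  split; first by apply/eqP; rewrite -subr_eq0 eB.
    by apply/eqP; rewrite eq_sym -subr_eq0 addrC eC.
  by apply/eqP; rewrite -addr_eq0 addrC eD.
by congr block_mx; rewrite ?linearN /= ?trmxK ?opprK ?addNr ?subrr.
Qed.

(* The slice x0 + g^y0 attached to the sl_2-triple of x0. *)
Lemma sliceE :
  slice = [set A | exists2 z, sp z /\ z *m y0 = y0 *m z & A = x0 + z].
Proof.
apply/seteqP; split=> A /=.
  case=> Z1 [Z2 [/eqP]]; rewrite addr_eq0 => /eqP eZ1 eZ2 ->.
  exists (block_mx Z1 0 Z2 Z1); last by rewrite add_block_mx !add0r addr0.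
  split; first by apply/sp_blockE; split; rewrite ?trmx0 -?eZ2 -?eZ1.
  by rewrite !mulmx_block !(mulmx0, mul0mx, mulmx1, mul1mx, addr0, add0r).
case=> z; rewrite -[z]submxK; move: (ulsubmx z) (ursubmx z) (dlsubmx z) (drsubmx z).
move=> a b c d [/sp_blockE[_ ec ed]].
rewrite !mulmx_block !(mulmx0, mul0mx, mulmx1, mul1mx, addr0, add0r).
move=> /eq_block_mx[eb _ eda _] ->.
exists a, c; split=> //.
  by rewrite -{1}eda ed addNr.
by rewrite add_block_mx !add0r eb addr0 eda.
Qed.

End Slice.
Arguments slice {F}.

(* Sym^2(F^2/{+-1}) = F^4/<sigma, tau>, with coordinates (x1, x2, y1, y2) on F^4. *)
Section WreathProduct.
Variable F : comUnitRingType.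

Definition sigma : 'M[F]_(2 + 2) := block_mx 0 1%:M 1%:M 0.
Definition tau : 'M[F]_(2 + 2) := block_mx (- 1%:M) 0 0 1%:M.

Lemma sigmaE (x y : 'rV[F]_2) : row_mx x y *m sigma = row_mx y x.
Proof. by rewrite mul_row_block !mulmx0 !mulmx1 add0r addr0. Qed.

Lemma tauE (x y : 'rV[F]_2) : row_mx x y *m tau = row_mx (- x) y.
Proof. by rewrite mul_row_block !mulmx0 mulmxN !mulmx1 add0r addr0. Qed.

Definition wreath_group : set 'M[F]_(2 + 2) := generated_group [set sigma; tau].

End WreathProduct.
Arguments wreath_group : clear implicits.

(* Main.v *)
From HB Require Import structures.
Require Import Defs.
From mathcomp Require Import all_boot all_order all_algebra.
From mathcomp Require Import boolp classical_sets reals complex mpoly.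
From mathcomp Require Import ssrcomplements ring.

Set Implicit Arguments.
Unset Strict Implicit.
Unset Printing Implicit Defensive.

Import GRing.Theory Num.Theory.
Local Open Scope ring_scope.
Local Open Scope classical_set_scope.

(** A matrix of the slice is determined by a vector s, with [Z1] the matrix N
    of the cross product by s, and by a symmetric matrix D, with
    [Z2 = N^2 - D]: the entries of s and D are nine free coordinates. All
    matrices A of the orbit satisfy [tr A^2 = 0] and [A^4 = 0], and on the
    slice these equations amount to [tr D = - 4 s.s], [s D = 0] and the
    vanishing of the 2x2 minors of D ([slice_ideal_tr], [slice_ideal_mul],
    [slice_ideal_exch]). So [D = d^T d] for a vector d, unique up to sign, with
    [s.d = 0] and [4 s.s + d.d = 0]. In terms of [u = (2 s + d) / 4] and
    [v = (2 s - d) / 4] the two equations say that u and v are isotropic, and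
    changing the sign of d exchanges u and v. The cone of isotropic vectors of
    C^3 is C^2/{+-1}, by [x |-> (x1^2 - x2^2, i (x1^2 + x2^2), 2 x1 x2)]. This
    identifies the intersection with the set of pairs (x, y) up to the signs of
    x and y and up to order.

    The isomorphism is the pullback of polynomials along the resulting map
    [(x, y) |-> wreath_mx x y]. It kills the ideal of the orbit closure: where
    [s.s] does not vanish, [wreath_mx x y] is conjugate to the given element of
    the orbit, because type (4, 2) has a normal form under the symplectic group
    ([subregular_nfP]), and the other points follow by density
    ([wreath_pullback_orbit0]).

    Kernel and image of the pullback are found by one device. A monomial of
    even degree in d is lifted to a polynomial in D by pairing its factors,
    [d_i d_j d_k d_l |-> D_ij D_kl]; the choice of the pairs does not matter
    once D is symmetric with vanishing 2x2 minors ([pairprod_perm]). The same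
    works for the passage from x to the products [x_i x_j]. The two linear
    maps obtained, [slice_lift] and [double_lift], invert the pullbacks
    modulo the respective relations. Hence every polynomial killed by the
    pullback lies in the ideal generated by the equations of the slice,
    [tr A^2] and the entries of [A^4] ([pullback_inj]); in particular these
    generate the ideal of T. At points the lifts are averages over the
    changes of signs, so that the lifts of an invariant polynomial pull back
    to it ([wreath_pullback_surj]). *)

(** * Products over pairs *)

Lemma seq_pair_ind (T : Type) (P : seq T -> Prop) :
  P [::] -> (forall i, P [:: i]) -> (forall i j l, P l -> P [:: i, j & l]) ->
  forall l, P l.
Proof.
move=> P0 P1 P2; fix ind 1 => -[|i [|j l]].
- exact: P0.
- exact: P1.
- exact/P2/ind.
Qed.

Section PairProduct.
Variables (I : eqType) (Q : comPzRingType) (M : I -> I -> Q).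

(** The value that a ring morphism with [z_i z_j |-> M i j] must take on the
    product of the [z_i] for i in l. An odd product gets 0, so that the
    linear extension keeps the even part of a polynomial. *)
Fixpoint pairprod (l : seq I) : Q :=
  if l is i :: l1 then
    if l1 is j :: l2 then M i j * pairprod l2 else 0
  else 1.

Lemma pairprod_odd l : odd (size l) -> pairprod l = 0.
Proof.
by elim/seq_pair_ind: l => //= i j l IH; rewrite negbK => /IH ->; rewrite mulr0.
Qed.

Hypothesis M_sym : forall i j, M i j = M j i.
Hypothesis M_exch : forall i j k l, M i j * M k l = M i k * M j l.

Lemma pairprod_swap l i j l' :
  pairprod (l ++ i :: j :: l') = pairprod (l ++ j :: i :: l').
Proof.
elim/seq_pair_ind: l => [|a|a b l /= ->] //=; first by rewrite M_sym.
by case: l' => [|k l']; rewrite ?mulr0 //= !mulrA M_exch.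
Qed.

(** Symmetry of M exchanges two factors of a pair, the exchange relation two
    factors of consecutive pairs; together these give all transpositions of
    neighbours. *)
Lemma pairprod_perm l l' : perm_eq l l' -> pairprod l = pairprod l'.
Proof.
have move_front l0 l1 i l2 :
    pairprod (l0 ++ l1 ++ i :: l2) = pairprod (l0 ++ i :: l1 ++ l2).
  elim: l1 l0 => //= a l1 IH l0.
  by rewrite -cat_rcons IH cat_rcons pairprod_swap.
suff gen l0 : perm_eq l l' -> pairprod (l0 ++ l) = pairprod (l0 ++ l').
  exact: (gen [::]).
elim: l l' l0 => [|i l IH] l' l0; first by rewrite perm_sym => /perm_nilP ->.
move=> eq_l; have i_l' : i \in l' by rewrite -(perm_mem eq_l) mem_head.
case/splitPr: l' / i_l' eq_l => l1 l2; rewrite move_front => eq_l.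
rewrite -!cat_rcons; apply: IH; rewrite -(perm_cons i);
  apply: perm_trans eq_l _.
by rewrite -cat1s perm_catCA.
Qed.

End PairProduct.

Lemma pairprod_rmorph (I : eqType) (Q Q' : comPzRingType) (M : I -> I -> Q)
    (f : {rmorphism Q -> Q'}) l :
  f (pairprod M l) = pairprod (fun i j => f (M i j)) l.
Proof.
elim/seq_pair_ind: l => [|i|i j l IH] /=; rewrite ?rmorph1 ?rmorph0 //.
by rewrite rmorphM IH.
Qed.

(** An odd product is 0 on the left and cancels on the right: this computes
    the average over z and - z. *)
Lemma pairprod_rank1 (I : eqType) (Q : comPzRingType) (z : I -> Q) l :
  pairprod (fun i j => z i * z j) l *+ 2 =
  \prod_(i <- l) z i + \prod_(i <- l) - z i.
Proof.
elim/seq_pair_ind: l => [|i|i j l IH] /=.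
- by rewrite !big_nil mulr2n.
- by rewrite !big_seq1 subrr mul0rn.
by rewrite -mulrnAr IH !big_cons mulrDr !mulNr mulrN opprK !mulrA.
Qed.

(** * Polynomials and monomials *)

Section Lift.
Variables (F : comNzRingType) (n : nat) (V : lmodType F).
Variable E : 'X_{1..n} -> V.

Definition mlift (p : {mpoly F[n]}) : V := \sum_(m <- msupp p) p@_m *: E m.

Lemma mliftwE k p : (msize p <= k)%N ->
  mlift p = \sum_(m : 'X_{1..n < k}) p@_m *: E m.
Proof.
move=> lt_pk; rewrite /mlift (big_mksub 'X_{1..n < k}) //=; first last.
- by move=> m /msize_mdeg_lt /leq_trans; apply.
- exact: msupp_uniq.
by rewrite big_rmcond //= => i /memN_msupp_eq0 ->; rewrite scale0r.
Qed.

Lemma mliftP c p q : mlift (c *: p + q) = c *: mlift p + mlift q.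
Proof.
pose k := maxn (msize (c *: p + q)) (maxn (msize p) (msize q)).
rewrite !(@mliftwE k) ?leq_max ?leqnn ?orbT // scaler_sumr -big_split /=.
by apply: eq_bigr => m _; rewrite mcoeffD mcoeffZ scalerDl scalerA.
Qed.

HB.instance Definition _ :=
  GRing.isLinear.Build F {mpoly F[n]} V _ mlift mliftP.

Lemma mliftX m : mlift 'X_[m] = E m.
Proof. by rewrite /mlift msuppX big_seq1 mcoeffX eqxx scale1r. Qed.

End Lift.

Lemma mpoly_ring_ind (F : comNzRingType) n (P : {mpoly F[n]} -> Prop) :
    (forall c, P c%:MP) -> (forall p q, P p -> P q -> P (p + q)) ->
    (forall p q, P p -> P q -> P (p * q)) -> (forall i, P 'X_i) ->
  forall p, P p.
Proof.
move=> PC PD PM PX p; rewrite [p]mpolyE; elim/big_rec: _ => [|m q _ Pq].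
  by rewrite -(mpolyC0 n); apply: PC.
apply: PD Pq; rewrite -mul_mpolyC; apply: (PM) => //.
rewrite mpolyXE_id; elim/big_rec: _ => [|i r _ Pr]; first exact: (PC 1).
apply: (PM _ _ _ Pr); elim: (m i) => [|k IH]; first by rewrite expr0;
  exact: (PC 1).
by rewrite exprS; apply: PM.
Qed.

Lemma mpoly_lin_ind (F : comNzRingType) n (P : {mpoly F[n]} -> Prop) :
    P 0 -> (forall c p q, P p -> P q -> P (c *: p + q)) ->
    (forall m, P 'X_[m]) ->
  forall p, P p.
Proof. by move=> P0 PL PX; elim/mpolyind => // c m p _ _ Pp; apply: PL. Qed.

Section ExponentSequence.
Variables (n k : nat) (h : 'I_k -> 'I_n).

Definition mseq (m : 'X_{1..n}) : seq 'I_k :=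
  flatten [seq nseq (m (h i)) i | i <- enum 'I_k].

Lemma count_mseq m i : count_mem i (mseq m) = m (h i).
Proof.
rewrite /mseq count_flatten -map_comp sumnE big_map big_enum /=.
rewrite (bigD1 i) //= big1 ?addn0 => [|j /negPf ne].
  by rewrite count_nseq /= eqxx mul1n.
by rewrite count_nseq /= ne.
Qed.

Lemma mseqP (m : 'X_{1..n}) l : (forall i, m (h i) = count_mem i l) ->
  perm_eq (mseq m) l.
Proof. by move=> eq_ml; apply/allP => i _ /=; rewrite count_mseq eq_ml. Qed.

Lemma mseq_out (m : 'X_{1..n}) i : i \notin codom h ->
  mseq (m + U_(i)) = mseq m.
Proof.
move=> /codomP out; congr flatten; apply: eq_map => j; congr nseq.
by rewrite mnmDE mnm1E; case: eqP => [e|]; [case: out; exists j|rewrite addn0].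
Qed.

Lemma prod_mseq (Q : comPzRingType) (z : 'I_k -> Q) m :
  \prod_(i <- mseq m) z i = \prod_i z i ^+ m (h i).
Proof.
rewrite /mseq big_flatten big_map big_enum; apply: eq_bigr => i _.
by rewrite big_nseq -Monoid.iteropE.
Qed.

Hypothesis h_inj : injective h.

Lemma mseq_in (m : 'X_{1..n}) i : perm_eq (mseq (m + U_(h i))) (i :: mseq m).
Proof.
apply: mseqP => j; rewrite /= count_mseq mnmDE mnm1E (inj_eq h_inj).
by rewrite addnC.
Qed.

Lemma mseq_gt0 (m : 'X_{1..n}) i : i \in mseq m ->
  exists m', m = (m' + U_(h i))%MM.
Proof.
rewrite -has_pred1 has_count count_mseq => m_gt0.
exists (m - U_(h i))%MM; rewrite submK //; apply/mnm_lepP => j.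
by rewrite mnm1E; case: eqP => // <-.
Qed.

End ExponentSequence.

Lemma poly_eq0_forall (F : numDomainType) (p : {poly F}) :
  (forall t, p.[t] = 0) -> p = 0.
Proof.
move=> p0; apply: (@roots_geq_poly_eq0 _ p [seq i%:R | i <- iota 0 (size p)]).
- by apply/allP => t _; apply/rootP/p0.
- by rewrite map_inj_uniq ?iota_uniq // => i j /eqP; rewrite eqr_nat => /eqP.
- by rewrite size_map size_iota.
Qed.

(** Induction on the number of variables: once the others are fixed, p is a
    polynomial in the last variable with infinitely many roots, so each of
    its coefficients vanishes at every point. *)
Lemma mpoly_eq0_forall (F : numDomainType) n (p : {mpoly F[n]}) :
  (forall v, p.@[v] = 0) -> p = 0.
Proof.
elim: n p => [|n IH] p p0.
  have [c p_c] : exists c, p = c%:MP.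
    exists p@_0%MM; apply/mpolyP => m; rewrite mcoeffC.
    have -> : m = 0%MM by apply/mnmP => -[].
    by rewrite eqxx mulr1.
  by move: (p0 (fun=> 0)); rewrite p_c mevalC => ->.
have muni0 : muni p = 0.
  apply/polyP => k; rewrite coef0; apply: IH => v.
  have: map_poly (meval v) (muni p) = 0.
    apply: poly_eq0_forall => t.
    pose w (i : 'I_n.+1) := if unlift ord_max i is Some j then v j else t.
    rewrite -(p0 w) muniE [in RHS](mpolyE p).
    rewrite !raddf_sum /= horner_sum; apply: eq_bigr => m _.
    rewrite map_polyZ /= hornerZ map_polyXn hornerXn mevalZ /= [in RHS]mevalZ.
    rewrite -mulrA; congr (_ * _); rewrite !mevalX big_ord_recr /=;
      congr (_ * _).
      apply: eq_bigr => i _; rewrite mnmE; congr (_ ^+ _).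
      have -> : widen_ord (leqnSn n) i = lift ord_max i.
        by apply/val_inj; rewrite /= /bump leqNgt ltn_ord.
      by rewrite /w liftK.
    by rewrite /w unlift_none.
  by move/polyP => /(_ k); rewrite coef_map coef0.
apply/mpolyP => m; rewrite mcoeff0.
move: muni0 => /polyP/(_ (m ord_max)); rewrite muniE coef_sum coef0.
move/mpolyP=> /(_ [multinom m (widen_ord (leqnSn n) i) | i < n]).
rewrite mcoeff0 raddf_sum /= => eq0.
have [m_in|/memN_msupp_eq0 //] := boolP (m \in msupp p).
move: eq0; rewrite (bigD1_seq m) ?msupp_uniq //= big1 => [|m' ne].
  by rewrite coefZ coefXn eqxx mulr1 mcoeffZ mcoeffX eqxx mulr1 addr0.
rewrite coefZ coefXn; case: eqP => [eq_max|]; last by rewrite mulr0 mcoeff0.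
rewrite mulr1 mcoeffZ mcoeffX; case: eqP => [eq_w|]; last by rewrite mulr0.
case/eqP: ne; apply/mnmP => i; have [j ->|->] := unliftP ord_max i; last first.
  by rewrite eq_max.
move/mnmP: eq_w => /(_ j); rewrite !mnmE.
suff -> : widen_ord (leqnSn n) j = lift ord_max j by [].
by apply/val_inj; rewrite /= /bump leqNgt ltn_ord.
Qed.

(** * Powers of a matrix of the slice *)

Local Notation i0 := (@Ordinal 3 0 isT).
Local Notation i1 := (@Ordinal 3 1 isT).
Local Notation i2 := (@Ordinal 3 2 isT).

Lemma forall_ord3 (P : 'I_3 -> Prop) : P i0 -> P i1 -> P i2 -> forall i, P i.
Proof.
by move=> P0 P1 P2 [[|[|[|//]]] lt_i]; rewrite (bool_irrelevance lt_i isT).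
Qed.

Lemma sum_ord3 (V : nmodType) (f : 'I_3 -> V) :
  \sum_(i < 3) f i = f i0 + f i1 + f i2.
Proof.
rewrite !big_ord_recl big_ord0 addr0 addrA.
by congr (f _ + f _ + f _); apply/val_inj.
Qed.

Section SliceAlgebra.
Variable B : comNzRingType.
Implicit Types (s r : 'rV[B]_3) (D : 'M[B]_3).

(** The matrix of [v |-> v x s]; every antisymmetric 3x3 matrix is of this
    form when 2 is regular. *)
Definition cross_mx s : 'M[B]_3 :=
  \matrix_(i, j) nth 0 (nth [::]
    [:: [:: 0; - s 0 i2; s 0 i1]; [:: s 0 i2; 0; - s 0 i0];
        [:: - s 0 i1; s 0 i0; 0]] i) j.

(** Taking [N^2 - Z2] as coordinate instead of [Z2] turns the equation
    [A^4 = 0] into rank conditions on D. *)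
Definition slice_mx s D : 'M[B]_(3 + 3) :=
  block_mx (cross_mx s) 1%:M (cross_mx s *m cross_mx s - D) (cross_mx s).

Definition normsq s : B := \sum_i s 0 i ^+ 2.

Lemma tr_cross_mx s : (cross_mx s)^T = - cross_mx s.
Proof.
by apply/matrixP; elim/forall_ord3; elim/forall_ord3;
  rewrite !mxE //= ?opprK ?oppr0.
Qed.

Lemma cross_mx_sqr s : cross_mx s *m cross_mx s = s^T *m s - (normsq s)%:M.
Proof.
rewrite /normsq sum_ord3; apply/matrixP.
by elim/forall_ord3; elim/forall_ord3;
  rewrite !mxE !sum_ord3 !mxE /= big_ord1 !mxE; ring.
Qed.

(** The left side is antisymmetric, so it has to be a [cross_mx]. *)
Lemma cross_mx_anticomm s D : D^T = D ->
  cross_mx s *m D + D *m cross_mx s = cross_mx (\tr D *: s - s *m D).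
Proof.
move=> symD; have D_sym i j : D i j = D j i by rewrite -{1}symD mxE.
apply/matrixP; rewrite /mxtrace sum_ord3.
by elim/forall_ord3; elim/forall_ord3; rewrite !mxE !sum_ord3 !mxE /= ?sum_ord3
 ?(D_sym i1 i0) ?(D_sym i2 i0) ?(D_sym i2 i1); ring.
Qed.

Lemma cross_mxZ c s : cross_mx (c *: s) = c *: cross_mx s.
Proof.
by apply/matrixP; elim/forall_ord3; elim/forall_ord3;
  rewrite !mxE /= ?mulr0 ?mulrN // !mxE.
Qed.

Lemma mul_row_cross_mx s : s *m cross_mx s = 0.
Proof.
apply/rowP; apply: forall_ord3; rewrite !mxE sum_ord3 !mxE /=; ring.
Qed.

Lemma cross_mx_cube s : cross_mx s *m cross_mx s *m cross_mx s = - normsq s *: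
  cross_mx s.
Proof.
by rewrite cross_mx_sqr mulmxBl -mulmxA mul_row_cross_mx mulmx0 sub0r
  mul_scalar_mx scaleNr.
Qed.

Section Powers.
Variables (s : 'rV[B]_3) (D : 'M[B]_3).
Hypothesis D_sym : D^T = D.
Let N := cross_mx s.
Let q := normsq s.
Let rho := \tr D + 4 * q.
Let r := s *m D.
Let P := 2 *: (N *m N) - D.
Let A := slice_mx s D.

(** The quantities rho and r vanish on the intersection with the orbit
    closure; the formulas below isolate them. *)
Lemma slice_sqr :
  A *m A = block_mx P (2 *: N) ((2 * q - rho) *: N + cross_mx r) P.
Proof.
have anti : N *m D + D *m N = \tr D *: N - cross_mx r.
  rewrite cross_mx_anticomm // -/r /N; apply/matrixP.
  elim/forall_ord3; elim/forall_ord3; rewrite !mxE /= ?mxE; ring.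
rewrite /A /slice_mx -/N mulmx_block !mulmx1 !mul1mx; congr block_mx.
- by rewrite /P scaler_nat mulr2n addrA.
- by rewrite scaler_nat mulr2n.
- rewrite mulmxBl mulmxBr !mulmxA addrACA -opprD [X in - X]addrC anti
    cross_mx_cube -/q.
  rewrite -/N opprB addrCA addrA /rho.
  by apply/matrixP => i j; rewrite !mxE; ring.
- by rewrite /P scaler_nat mulr2n addrAC.
Qed.

Lemma tr_slice_sqr : \tr (A *m A) = - rho *+ 2.
Proof.
rewrite slice_sqr mxtrace_block -mulr2n; congr (_ *+ 2).
rewrite /P linearB /= linearZ /= cross_mx_sqr linearB /= mxtrace_scalar
  mxtrace_mulC.
rewrite trace_mx11 mxE sum_ord3 !mxE /rho /q /normsq sum_ord3; ring.
Qed.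

Lemma slice_pow4_ur : ursubmx (A *m A *m (A *m A)) = 2 *: cross_mx (r - rho *:
  s).
Proof.
rewrite slice_sqr mulmx_block block_mxKur -!scalemxAr -!scalemxAl -scalerDr.
congr (_ *: _); rewrite mulmxBl mulmxBr -scalemxAl -scalemxAr mulmxA.
rewrite addrACA -opprD [X in - X]addrC cross_mx_anticomm // cross_mx_cube -/q
  -/N -/r.
apply/matrixP; elim/forall_ord3; elim/forall_ord3; rewrite !mxE /= ?mxE /rho;
  ring.
Qed.

(** When rho and r vanish, what remains is [D^2 - (tr D) D]. *)
Lemma slice_pow4_ul : ulsubmx (A *m A *m (A *m A)) =
  D *m D - \tr D *: D + rho *: (D - 2 *: (N *m N))
  - 2 *: (s^T *m r + (\sum_i s 0 i * r 0 i)%:M).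
Proof.
have sym i j : D i j = D j i by rewrite -{1}D_sym mxE.
rewrite slice_sqr mulmx_block block_mxKul /P cross_mx_sqr /rho /q /normsq
  /mxtrace !sum_ord3.
apply/matrixP; elim/forall_ord3; elim/forall_ord3;
  rewrite !(mxE, sum_ord3, big_ord1) /= ?(sym i1 i0) ?(sym i2 i0) ?(sym i2 i1);
    ring.
Qed.

End Powers.

End SliceAlgebra.

(** * Ideals containing the nilpotency equations *)

Lemma idealN (A : comNzRingType) (I : ideal A) a : I a -> I (- a).
Proof. by rewrite -mulN1r; apply: idealM. Qed.

Lemma idealB (A : comNzRingType) (I : ideal A) a b : I a -> I b -> I (a - b).
Proof. by move=> Ia /idealN; apply: idealD. Qed.

Lemma ideal_sum_in (A : comNzRingType) (I : ideal A) (T : finType) (f : T ->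
  A) :
  (forall i, I (f i)) -> I (\sum_i f i).
Proof.
by move=> If; elim/big_ind: _ => *; [exact: ideal0 | exact: idealD | exact: If].
Qed.

Section SliceIdeal.
Variables (B : comNzRingType) (s : 'rV[B]_3) (D : 'M[B]_3) (I : ideal B).
Hypothesis half : forall b, I (b *+ 2) -> I b.
Hypothesis D_sym : D^T = D.
Let A := slice_mx s D.
Hypothesis tr_sqr : I (\tr (A *m A)).
Hypothesis pow4 : forall i j, I ((A *m A *m (A *m A)) i j).

Lemma slice_ideal_tr : I (\tr D + 4 * normsq s).
Proof.
by apply: half; rewrite -[_ *+ 2]opprK -mulNrn -tr_slice_sqr //; apply: idealN.
Qed.

(** The upper right block of [A^4] is twice the cross product matrix of
    [s D - rho s], and rho is in the ideal. *)
Lemma slice_ideal_mul i : I ((s *m D) 0 i).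
Proof.
pose t : 'rV[B]_3 := s *m D - (\tr D + 4 * normsq s) *: s.
suff It j : I (t 0 j).
  have -> : (s *m D) 0 i = t 0 i + s 0 i * (\tr D + 4 * normsq s).
    by rewrite /t !mxE; ring.
  by apply: idealD => //; apply: idealM; exact: slice_ideal_tr.
have Icross (a b : 'I_3) : I (cross_mx t a b).
  apply: half; move: (pow4 (lshift 3 a) (rshift 3 b)).
  have -> : (A *m A *m (A *m A)) (lshift 3 a) (rshift 3 b) =
      ursubmx (A *m A *m (A *m A)) a b by rewrite !mxE.
  by rewrite slice_pow4_ur // mxE mulr_natl.
move: j; apply: forall_ord3.
- by move: (Icross i2 i1); rewrite /cross_mx mxE /=.
- by move: (Icross i0 i2); rewrite /cross_mx mxE /=.
- by move: (Icross i1 i0); rewrite /cross_mx mxE /=.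
Qed.

Lemma slice_ideal_sqr i j : I ((D *m D - \tr D *: D) i j).
Proof.
move: (pow4 (lshift 3 i) (lshift 3 j)).
have -> : (A *m A *m (A *m A)) (lshift 3 i) (lshift 3 j) =
    ulsubmx (A *m A *m (A *m A)) i j by rewrite !mxE.
rewrite slice_pow4_ul //; set r := s *m D; set rho := (X in X *: (D - _)).
have Ir k : I (r 0 k) by apply: slice_ideal_mul.
have Irho : I rho by apply: slice_ideal_tr.
move: r rho Ir Irho => r rho Ir Irho.
set F := D *m D - _; set S := \sum_i _; set R1 := D - _;
  rewrite -addrA mxE => IF.
rewrite -[F i j](addrK ((rho *: R1 - 2 *: (s^T *m r + S%:M)) i j)).
apply: idealB; [exact: IF | rewrite !mxE big_ord1].
apply: idealB; first by rewrite mulrC; apply: idealM.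
apply/idealM/idealD; first exact: idealM.
by rewrite -mulr_natr mulrC; apply/idealM/ideal_sum_in => k; apply: idealM.
Qed.

(** For a 3x3 matrix, [adj D = F + e2] where [F = D^2 - (tr D) D] and e2 is
    the second invariant of D, and [tr F = - 2 e2]. As the entries of F are
    in the ideal, so are those of [adj D], which are the 2x2 minors of D up
    to sign. *)
Lemma slice_ideal_exch i j k l : I (D i j * D k l - D i k * D j l).
Proof.
have sym (a b : 'I_3) : D a b = D b a by rewrite -{1}D_sym mxE.
pose F : 'M[B]_3 := D *m D - \tr D *: D.
have IF (a b : 'I_3) : I (F a b) by apply: slice_ideal_sqr.
(* This is - 2 times the second invariant of D. *)
pose e2 := (F i0 i0 + F i1 i1 + F i2 i2).
have Ie : I e2 by rewrite /e2; do ?apply: idealD.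
have main : forall a b c d : 'I_3, (a < d)%N -> (b < c)%N ->
  I (D a b * D c d - D a c * D b d).
  have eqI (x y : B) : I x -> y *+ 2 = x -> I y
    by move=> Ix eq_yx; apply: half; rewrite eq_yx.
  (* Twice the entries of adj D, then their opposites. *)
  have F00 : I (F i0 i0 *+ 2 - e2)
    by rewrite mulr2n; do ?[apply: idealB | apply: idealD].
  have F11 : I (F i1 i1 *+ 2 - e2)
    by rewrite mulr2n; do ?[apply: idealB | apply: idealD].
  have F22 : I (F i2 i2 *+ 2 - e2)
    by rewrite mulr2n; do ?[apply: idealB | apply: idealD].
  have F01 : I (F i0 i1 *+ 2) by rewrite mulr2n; do ?apply: idealD.
  have F02 : I (F i0 i2 *+ 2) by rewrite mulr2n; do ?apply: idealD.
  have F12 : I (F i1 i2 *+ 2) by rewrite mulr2n; do ?apply: idealD.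
  have := (idealN F00, idealN F11, idealN F22, idealN F01, idealN F02,
    idealN F12).
  move: F00 F11 F22 F01 F02 F12.
  rewrite /e2 /F /mxtrace !(mxE, sum_ord3) !(sym i1 i0, sym i2 i0, sym i2 i1).
  move=> F00 F11 F22 F01 F02 F12 [[[[[G00 G11] G22] G01] G02] G12].
  elim/forall_ord3; elim/forall_ord3; elim/forall_ord3;
    elim/forall_ord3 => // _ _;
  rewrite ?(sym i1 i0) ?(sym i2 i0) ?(sym i2 i1);
  first [ by apply: (eqI _ _ F00); ring | by apply: (eqI _ _ F11); ring
        | by apply: (eqI _ _ F22); ring
        | by apply: (eqI _ _ F01); ring | by apply: (eqI _ _ F02); ring
        | by apply: (eqI _ _ F12); ring
        | by apply: (eqI _ _ G00); ring | by apply: (eqI _ _ G11); ring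
        | by apply: (eqI _ _ G22); ring
        | by apply: (eqI _ _ G01); ring | by apply: (eqI _ _ G02); ring
        | by apply: (eqI _ _ G12); ring ].
(* Exchanging a and d, or b and c, changes the sign of the minor. *)
have main' (a b c d : 'I_3) : (b < c)%N -> I (D a b * D c d - D a c * D b d).
  have [lt_ad|lt_da|/val_inj ->] := ltngtP a d; [exact: main| |] => lt_bc.
    rewrite -[_ - _]opprK opprB; apply: idealN;
      move: (main _ _ _ _ lt_da lt_bc).
    by rewrite (sym d b) (sym d c) (sym a b) (sym a c) mulrC [X in _ - X]mulrC.
  by rewrite (sym d b) (sym c d) mulrC subrr; apply: ideal0.
have [lt_jk|lt_kj|/val_inj ->] := ltngtP j k; first exact: main'.
  by rewrite -opprB; apply/idealN/main'.
by rewrite subrr; apply: ideal0.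
Qed.

End SliceIdeal.

(** * Symplectic normal form of nilpotents of type (4, 2) *)

Section SymplecticForm.
Variables (C : fieldType) (n : nat).
Implicit Types (u v w : 'cV[C]_(n + n)) (x g h : 'M[C]_(n + n)).

Definition symp u v : C := (u^T *m omega *m v) 0 0.

Lemma sympDl u u' v : symp (u + u') v = symp u v + symp u' v.
Proof. by rewrite /symp linearD /= !mulmxDl mxE. Qed.
Lemma sympDr u v v' : symp u (v + v') = symp u v + symp u v'.
Proof. by rewrite /symp mulmxDr mxE. Qed.
Lemma sympZl a u v : symp (a *: u) v = a * symp u v.
Proof. by rewrite /symp linearZ /= -!scalemxAl mxE. Qed.
Lemma sympZr a u v : symp u (a *: v) = a * symp u v.
Proof. by rewrite /symp -scalemxAr mxE. Qed.
Lemma sympNl u v : symp (- u) v = - symp u v.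
Proof. by rewrite -scaleN1r sympZl mulN1r. Qed.
Lemma sympNr u v : symp u (- v) = - symp u v.
Proof. by rewrite -scaleN1r sympZr mulN1r. Qed.

Lemma tr_omega : omega^T = - omega :> 'M[C]_(n + n).
Proof. by rewrite /omega tr_block_mx opp_block_mx !linearN /= trmx1 !trmx0 opprK
  oppr0. Qed.

Lemma omega_sqr : omega *m omega = - 1%:M :> 'M[C]_(n + n).
Proof.
rewrite /omega mulmx_block !(mulmx0, mul0mx, mulmx1, mul1mx, add0r, addr0).
by rewrite scalar_mx_block opp_block_mx oppr0.
Qed.

Lemma sympC u v : symp u v = - symp v u.
Proof.
rewrite /symp; have -> : u^T *m omega *m v = (v^T *m omega^T *m u)^T.
  by rewrite !trmx_mul !trmxK mulmxA.
by rewrite mxE tr_omega mulmxN mulNmx mxE.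
Qed.

Lemma symp_nondeg v : (forall u, symp u v = 0) -> v = 0.
Proof.
move=> v0; suff: omega *m v = 0.
  by move/(congr1 (mulmx omega)); rewrite mulmxA omega_sqr mulmx0 mulNmx mul1mx
    => /eqP; rewrite oppr_eq0 => /eqP.
apply/colP => i; rewrite -[LHS]mul1r [RHS]mxE -(v0 (delta_mx i 0)) /symp
  trmx_delta -mulmxA.
by rewrite -rowE !mxE mul1r; under eq_bigr do rewrite mxE.
Qed.

Lemma symp_sp x u v : sp x -> symp (x *m u) v = - symp u (x *m v).
Proof.
rewrite /sp /= => /eqP; rewrite addr_eq0 => /eqP spx.
by rewrite /symp trmx_mul -!mulmxA [x^T *m _]mulmxA spx mulNmx mulmxN mxE
  !mulmxA.
Qed.

Lemma Sp_unit g : Sp g -> g \in unitmx.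
Proof.
rewrite /Sp /= => Spg; have: (- omega *m g^T *m omega) *m g = 1%:M.
  by rewrite !mulNmx -!mulmxA [g^T *m _]mulmxA Spg omega_sqr opprK.
by case/mulmx1_unit.
Qed.

Lemma SpM g h : Sp g -> Sp h -> Sp (g *m h).
Proof.
rewrite /Sp /= => Spg Sph.
by rewrite trmx_mul -!mulmxA [g^T *m _]mulmxA [_ *m omega *m _]mulmxA Spg
  mulmxA.
Qed.

Lemma SpV g : Sp g -> Sp (invmx g).
Proof.
move=> Spg; have gu := Sp_unit Spg; move: Spg; rewrite /Sp /= => Spg.
rewrite -{1}Spg !mulmxA -trmx_mul mulmxV // trmx1 mul1mx.
by rewrite -mulmxA mulmxV // mulmx1.
Qed.

End SymplecticForm.

(** By polarization a symmetric form that vanishes on the diagonal is zero. *)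
Lemma sym_form_neq0 (C : numFieldType) n (S : 'M[C]_n) :
  S^T = S -> S != 0 -> exists v : 'cV[C]_n, (v^T *m S *m v) 0 0 != 0.
Proof.
move=> symS /eqP S0; apply: contrapT => /forallNP S_0; apply: S0.
pose f (u v : 'cV[C]_n) : C := (u^T *m S *m v) 0 0.
have f0 v : f v v = 0 by apply/eqP; rewrite -[_ == _]negbK; apply/negP/S_0.
have fD u v : f (u + v) (u + v) = f u u + f u v + f v u + f v v.
  rewrite /f [(u + v)^T]linearD /= !mulmxDl !mulmxDr. by rewrite mxE [X in X +
    _]mxE [X in _ + X]mxE addrA.
have fC u v : f u v = f v u.
  have -> : f u v = (u^T *m S *m v)^T 0 0 by rewrite mxE.
  by rewrite !trmx_mul trmxK symS mulmxA.
have fE i j : f (delta_mx i 0) (delta_mx j 0) = S i j.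
  by rewrite /f trmx_delta -rowE -colE !mxE.
apply/matrixP => i j; rewrite mxE -fE.
have := fD (delta_mx i 0) (delta_mx j 0); rewrite !f0 [f (delta_mx j 0) _]fC.
by rewrite add0r addr0 -mulr2n => /esym/eqP; rewrite mulrn_eq0 => /eqP.
Qed.

Section SubregularNormalForm.
Variable C : numClosedFieldType.
Implicit Types (x g : 'M[C]_(3 + 3)) (u v w : 'cV[C]_(3 + 3)).

(** Nilpotent of type (4, 2) in sp_6: the first conditions leave the types
    (4, 2) and (4, 1, 1), and the rank excludes the latter. *)
Definition subregular x : Prop :=
  [/\ sp x, x *m x *m (x *m x) = 0, x *m (x *m x) != 0 & (3 < \rank x)%N].

Definition cols3 u0 u1 u2 : 'M[C]_(3 + 3, 3) :=
  \matrix_(i, j) nth 0 [:: u0; u1; u2] j i 0.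

Lemma mul_cols3 x u0 u1 u2 :
  x *m cols3 u0 u1 u2 = cols3 (x *m u0) (x *m u1) (x *m u2).
Proof.
by apply/matrixP => i; elim/forall_ord3; rewrite !mxE; apply: eq_bigr => k _;
  rewrite !mxE.
Qed.

Lemma gram_cols3 u0 u1 u2 v0 v1 v2 (a b : 'I_3) :
  ((cols3 u0 u1 u2)^T *m omega *m cols3 v0 v1 v2) a b =
  symp (nth 0 [:: u0; u1; u2] a) (nth 0 [:: v0; v1; v2] b).
Proof.
rewrite /symp -mulmxA -[in RHS]mulmxA !mxE; apply: eq_bigr => k _; rewrite !mxE.
by congr (_ * _); apply: eq_bigr => l _; rewrite !mxE.
Qed.

Lemma symp_cols3 u0 u1 u2 v (a : 'I_3) :
  ((cols3 u0 u1 u2)^T *m omega *m v) a 0 = symp (nth 0 [:: u0; u1; u2] a) v.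
Proof.
rewrite /symp -mulmxA -[in RHS]mulmxA !mxE; apply: eq_bigr => k _; rewrite !mxE.
by [].
Qed.

(** The matrix of x in the symplectic basis [v, - x v, w | x^3 v, x^2 v, x w]
    given by a chain of length 4 from v and a chain of length 2 from w. *)
Definition subregular_nf : 'M[C]_(3 + 3) :=
  block_mx (- delta_mx (1 : 'I_3) 0) 0
           (delta_mx (2%:R : 'I_3) 2%:R - delta_mx 1 1) (delta_mx 0 1).

(** The form [symp u (x^3 v)] is symmetric and not zero, so
    [symp v (x^3 v) = 1] for some v; adding a multiple of [x^2 v] gives also
    [symp v (x v) = 0]. The chain of v then spans a nondegenerate subspace,
    and Pi below is the orthogonal projection to its complement. If the
    symmetric form [symp (Pi u) (x (Pi u))] were zero, x would vanish on the
    complement and its rank would be at most 3. So the complement contains w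
    with [symp w (x w) = 1], and v and w generate the basis. *)
Lemma subregular_nfP x : subregular x ->
  exists2 g, Sp g & x *m g = g *m subregular_nf.
Proof.
move=> [spx x4 x3 rk_x].
have xx4 u : x *m (x *m (x *m (x *m u))) = 0
  by rewrite !mulmxA -[x *m x *m x *m x]mulmxA x4 mul0mx.
have symp_x u v : symp (x *m u) v = - symp u (x *m v) by apply: symp_sp.
have symp0 u : symp u u = 0.
  by have /eqP := sympC u u; rewrite -addr_eq0 -mulr2n mulrn_eq0 => /eqP.
have symp_2 u : symp u (x *m (x *m u)) = 0
  by rewrite -[LHS]opprK -symp_x symp0 oppr0.
have symp0r u : symp u 0 = 0 by rewrite -(scale0r u) sympZr mul0r.
have [v [v3 v1]] :
    exists v, symp v (x *m (x *m (x *m v))) = 1 /\ symp v (x *m v) = 0.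
  have [u] : exists u, symp u (x *m (x *m (x *m u))) != 0.
    have [||u u0] := @sym_form_neq0 _ _ (omega *m (x *m (x *m x))).
    - move: spx; rewrite /sp /= => /eqP; rewrite addr_eq0 => /eqP spx.
      have com (y : 'M[C]_(3+3)): x^T *m (omega *m y) = - (omega *m (x *m y)).
        by rewrite mulmxA spx mulNmx mulmxA.
      rewrite !trmx_mul tr_omega !mulmxN -!mulmxA -[x^T *m omega]mulmx1 -[x^T *m
        omega *m _]mulmxA.
      by rewrite com mulmx1 !(mulmxN, com) opprK !mulmxA opprK.
    - apply: contra x3 => /eqP; move/(congr1 (mulmx omega)).
      by rewrite [omega *m (omega *m _)]mulmxA omega_sqr mulNmx mul1mx mulmx0 =>
        /eqP; rewrite oppr_eq0.
    by exists u; rewrite /symp !mulmxA in u0 *.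
  move=> u0; set a := symp u _ in u0; pose c := (sqrtC a)^-1.
  have ca : c ^+ 2 * a = 1 by rewrite exprVn sqrtCK mulVf.
  have [u' a1] : exists u', symp u' (x *m (x *m (x *m u'))) = 1.
    by exists (c *: u); rewrite -!scalemxAr sympZl sympZr mulrA -expr2.
  pose k : C := - symp u' (x *m u') / 2.
  exists (u' + k *: (x *m (x *m u'))).
  rewrite !mulmxDr -!scalemxAr !xx4 !scaler0 !addr0.
  rewrite !(sympDl, sympDr, sympZl, sympZr) !symp_x ?xx4 ?symp0r.
  rewrite a1 ?symp0r ?xx4; split; first by ring.
  by rewrite /k; field.
pose Pi u := u + symp (x *m (x *m (x *m v))) u *: v
  - symp (x *m (x *m v)) u *: (x *m v)
  + symp (x *m v) u *: (x *m (x *m v)) - symp v u *: (x *m (x *m (x *m v))).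
have Pi_orth u : [/\ symp v (Pi u) = 0, symp (x *m v) (Pi u) = 0,
    symp (x *m (x *m v)) (Pi u) = 0 & symp (x *m (x *m (x *m v))) (Pi u) = 0].
  rewrite !symp_x /Pi !(mulmxDr, mulmxN) -!scalemxAr.
  rewrite !(sympDr, sympNr, sympZr, symp_x, symp0, xx4, mulmx0, symp0r, v3, v1,
    symp_2).
  by split; ring.
(* M is the matrix of Pi, and x = x (1 - M) if x vanishes on the complement. *)
have [u u0] : exists u, symp (Pi u) (x *m Pi u) != 0.
  apply: contrapT => /forallNP Pi0.
  pose M : 'M[C]_(3 + 3) := 1%:M + v *m ((x *m (x *m (x *m v)))^T *m omega)
    - (x *m v) *m ((x *m (x *m v))^T *m omega)
    + (x *m (x *m v)) *m ((x *m v)^T *m omega)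
    - (x *m (x *m (x *m v))) *m (v^T *m omega).
  have rank1 (p q y : 'cV[C]_(3 + 3)) :
    p *m (q^T *m omega) *m y = symp q y *: p.
    by rewrite -[p *m _ *m y]mulmxA [q^T *m _ *m y]mx11_scalar mul_mx_scalar.
  have PiE y : Pi y = M *m y by rewrite /M !(mulmxDl, mulNmx) !rank1 mul1mx.
  have Omx : (omega *m x)^T = omega *m x.
    move: spx; rewrite /sp /= => /eqP; rewrite addr_eq0 => /eqP spx.
    by rewrite trmx_mul tr_omega mulmxN spx opprK.
  have S0 : M^T *m (omega *m x) *m M = 0.
    apply/eqP/negPn/negP => /sym_form_neq0 [|y].
      by rewrite trmx_mul [(M^T *m _)^T]trmx_mul trmxK Omx mulmxA.
    move: (Pi0 y); rewrite !PiE /symp trmx_mul !mulmxA; exact.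
  have xPi y : x *m Pi y = 0.
    apply: symp_nondeg => u; have [p0 p1 p2 p3] := Pi_orth y.
    have vz z : symp z (x *m Pi y) = - symp (x *m z) (Pi y)
      by rewrite symp_x opprK.
    transitivity (symp (Pi u) (x *m Pi y)); last first.
      rewrite !PiE /symp trmx_mul !mulmxA -[u^T *m _ *m _]mulmxA.
      by rewrite -[u^T *m _ *m x]mulmxA -[u^T *m _ *m M]mulmxA -[M^T *m _ *m
        _]mulmxA S0 mulmx0 mul0mx mxE.
    rewrite [in RHS]/Pi !(sympDl, sympNl,
      sympZl) !vz xx4 [symp 0 _]sympC symp0r p1 p2 p3.
    by ring.
  have xM : x *m M = 0.
    apply/matrixP => i j; move: (xPi (delta_mx j 0)).
    by rewrite PiE mulmxA -colE => /colP/(_ i); rewrite !mxE.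
  move: rk_x; suff -> : x = - (x *m v) *m ((x *m (x *m (x *m v)))^T *m omega)
    + (x *m (x *m v)) *m ((x *m (x *m v))^T *m omega)
    - (x *m (x *m (x *m v))) *m ((x *m v)^T *m omega).
    rewrite ltnNge; case/negP.
    apply: leq_trans (mxrank_add _ _) _; rewrite mxrank_opp -[3%N]/(2 + 1)%N.
    apply: leq_add (mulmx_max_rank _ _).
    by apply: leq_trans (mxrank_add _ _) (leq_add (mulmx_max_rank _ _)
      (mulmx_max_rank _ _)).
  apply/eqP; rewrite -subr_eq0 -xM /M !(mulmxDr, mulmxN) mulmx1 !mulmxA.
  rewrite -[x *m x *m x *m x]mulmxA x4 !mul0mx subr0 !mulNmx !opprD !opprK.
  by rewrite !addrA.
pose w := (sqrtC (symp (Pi u) (x *m Pi u)))^-1 *: Pi u.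
have [w0 w1 w2 w3] : [/\ symp v w = 0, symp (x *m v) w = 0,
    symp (x *m (x *m v)) w = 0 & symp (x *m (x *m (x *m v))) w = 0].
  by have [p0 p1 p2 p3] := Pi_orth u; rewrite !sympZr p0 p1 p2 p3 mulr0.
have ww : symp w (x *m w) = 1.
  by rewrite /w -scalemxAr sympZl sympZr mulrA -expr2 exprVn sqrtCK mulVf.
clearbody w.
pose P1 := cols3 v (- (x *m v)) w.
pose P2 := cols3 (x *m (x *m (x *m v))) (x *m (x *m v)) (x *m w).
have [a1 a2 a3] : [/\ symp v (x *m w) = 0, symp v (x *m (x *m w)) = 0
    & symp v (x *m (x *m (x *m w))) = 0].
  by move: w1 w2 w3; rewrite !symp_x !opprK => /eqP;
    rewrite oppr_eq0 => /eqP -> ->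
    /eqP; rewrite oppr_eq0 => /eqP ->.
have [b0 b1 b2 b3] : [/\ symp w v = 0, symp w (x *m v) = 0,
    symp w (x *m (x *m v)) = 0 & symp w (x *m (x *m (x *m v))) = 0].
  by rewrite ![symp w _]sympC w0 w1 w2 w3 oppr0.
have values := (symp0, v1, v3, w0, ww, a1, a2, a3, b0, b1, b2, b3, xx4, symp_2,
  symp0r, mulmx0).
have SpP : Sp (row_mx P1 P2).
  rewrite /Sp /= tr_row_mx mul_col_mx mul_col_row /omega.
  congr block_mx; apply/matrixP; elim/forall_ord3; elim/forall_ord3;
    by rewrite -/omega gram_cols3 !mxE /= ?(sympNl,
      sympNr) ?symp_x !values ?oppr0 ?opprK.
(* x^2 w is orthogonal to the basis except to x w, so it is a multiple of w, and
   x is nilpotent. *)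
have xw2 : x *m (x *m w) = 0.
  pose a := symp (x *m w) (x *m (x *m w)).
  have xw2 : x *m (x *m w) + a *: w = 0.
    have OP_unit : (row_mx P1 P2)^T *m omega \in unitmx.
      by rewrite unitmx_mul unitmx_tr (Sp_unit SpP) /=;
        have /mulmx1_unit[] : omega *m - omega = 1%:M :> 'M[C]_(3+3)
          by rewrite mulmxN omega_sqr opprK.
    rewrite -[LHS](mulKmx OP_unit) [X in _ *m X](_ : _ = 0) ?mulmx0 //.
    rewrite tr_row_mx mul_col_mx mul_col_mx -[RHS]col_mx0; congr col_mx;
      apply/colP;
    elim/forall_ord3; rewrite symp_cols3 [RHS]mxE /= sympDr sympZr;
      by rewrite /a ?sympNl !symp_x !values; ring.
  have xwE : x *m (x *m w) = - a *: w
    by apply/eqP; rewrite scaleNr -addr_eq0 xw2.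
  have w_neq0 : w != 0.
    by apply/eqP => w_0; move/eqP: ww;
      rewrite w_0 mulmx0 symp0r eq_sym oner_eq0.
  have /eqP := xx4 w; rewrite xwE -!scalemxAr xwE scalerA scaler_eq0 (negPf
    w_neq0).
  by rewrite orbF mulrNN mulf_eq0 orbb => /eqP a0; rewrite a0 oppr0 scale0r.
exists (row_mx P1 P2) => //.
rewrite /subregular_nf mul_mx_row mul_row_block /P1 /P2 !mul_cols3 mulmxN xx4
  xw2.
move: (x *m (x *m (x *m v))) (x *m (x *m v)) (x *m v) (x *m w) => p3 p2 p1 pw.
by congr row_mx; apply/matrixP => i; elim/forall_ord3;
  rewrite !(mxE, sum_ord3) /=;
  ring.
Qed.

Lemma subregular_orbit x y : subregular x -> subregular y -> Sp_orbit x y.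
Proof.
move=> /subregular_nfP[g Spg xg] /subregular_nfP[h Sph yh].
have [gu hu] := (Sp_unit Spg, Sp_unit Sph).
exists (h *m invmx g); first exact/SpM/SpV.
have kx : h *m invmx g *m x = y *m (h *m invmx g).
  by rewrite mulmxA yh -[x in LHS](mulmxK gu) xg !mulmxA mulmxKV.
by rewrite kx mulmxK // unitmx_mul hu unitmx_inv.
Qed.

End SubregularNormalForm.

Lemma jordan_blockX (F : comUnitRingType) k e (i j : 'I_k) :
  (iter e (mulmx (jordan_block F k)) 1%:M) i j = (i + e == j)%N%:R.
Proof.
elim: e i => [|e IH] i /=; first by rewrite mxE addn0.
rewrite !mxE; have [lt_ik|ge_ik] := ltnP i.+1 k.
  rewrite (bigD1 (Ordinal lt_ik)) //= big1 => [|l ne]; last first.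
    by rewrite mxE; case: eqP => [e_l|_]; [case/eqP: ne;
      apply/val_inj | rewrite mul0r].
  by rewrite mxE eqxx mul1r addr0 IH addSnnS.
rewrite big1 => [|l _]; last first.
  rewrite mxE; case: eqP => [e_l|_]; last by rewrite mul0r.
  by move: (ltn_ord l); rewrite -e_l ltnNge ge_ik.
case: eqP => // e_j; move: (ltn_ord j); rewrite -e_j ltnNge.
by rewrite addnS (leq_trans ge_ik) // ltnS leq_addr.
Qed.

Lemma rank_jordan_block (F : fieldType) k :
  (k <= \rank (jordan_block F k.+1))%N.
Proof.
pose L := rowsub (widen_ord (leqnSn k)) (jordan_block F k.+1).
have LR : L *m (\matrix_(i, j) (i == lift ord0 j)%:R) = 1%:M.
  apply/matrixP => i j; rewrite !mxE (bigD1 (lift ord0 j)) //= big1 => [|l ne].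
    by rewrite !mxE eqxx mulr1 addr0 /= eqSS.
  by rewrite !mxE (negPf ne) mulr0.
rewrite -{1}(mxrank1 F k) -LR (leq_trans (mxrankM_maxl _ _)) //.
exact/mxrankS/rowsub_sub.
Qed.

Lemma nilpotent_type42_subregular (C : numClosedFieldType) (x : 'M[C]_(3 + 3)) :
  sp x -> nilpotent_type [:: 4; 2]%N x -> subregular x.
Proof.
move=> spx [P [Q [PQ QP xE]]].
pose J := jordan_mx C [:: 4; 2]%N.
have JE : J = Q *m x *m P by rewrite xE !mulmxA QP mul1mx -mulmxA QP mulmx1.
have x2 : x *m x = P *m (J *m J) *m Q.
  by rewrite xE -/J !mulmxA -[P *m J *m Q *m P]mulmxA QP mulmx1.
have x3 : x *m (x *m x) = P *m (J *m (J *m J)) *m Q.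
  by rewrite x2 xE -/J !mulmxA -[P *m J *m Q *m P]mulmxA QP mulmx1.
have JX e : iter e (mulmx J) 1%:M = block_mx (iter e (mulmx (jordan_block C 4))
  1%:M) 0 0
   (block_mx (iter e (mulmx (jordan_block C 2)) 1%:M) 0 0 (iter e (mulmx 0)
     1%:M)).
  elim: e => [|e IH]; first by rewrite -!scalar_mx_block.
  by rewrite /= IH /J /= !mulmx_block !(mulmx0, mul0mx, addr0, add0r).
have J2 : J *m J = iter 2 (mulmx J) 1%:M by rewrite /= mulmx1.
have J4 : J *m J *m (J *m J) = 0.
  have -> : J *m J *m (J *m J) = iter 4 (mulmx J) 1%:M
    by rewrite /= mulmx1 !mulmxA.
  have jordan4 k : (k <= 4)%N -> iter 4 (mulmx (jordan_block C k)) 1%:M = 0.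
    move=> le_k4; apply/matrixP => i j; rewrite jordan_blockX mxE.
    case: eqP => // e_j; move: (ltn_ord j); rewrite -e_j ltnNge.
    by rewrite (leq_trans le_k4) // leq_addl.
  by rewrite JX !jordan4 //= !mul0mx !block_mx0.
split=> //.
- rewrite x2; move: (J *m J) J4 => K K2.
  by rewrite !mulmxA -[P *m K *m Q *m P]mulmxA QP mulmx1 -[P *m K *m K]mulmxA K2
    mulmx0 mul0mx.
- apply/eqP => x3_0.
  have : J *m (J *m J) = 0.
    have := congr1 (fun y => Q *m y *m P) x3_0; rewrite x3.
    by rewrite !mulmxA QP mul1mx -[_ *m Q *m P]mulmxA QP mulmx1 mulmx0 mul0mx.
  have -> : J *m (J *m J) = iter 3 (mulmx J) 1%:M by rewrite /= mulmx1.
  rewrite JX => /matrixP/(_ (lshift _ (Ordinal (isT :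
    0 < 4)%N)) (lshift _ (Ordinal (isT : 3 < 4)%N))).
  by rewrite block_mxEul jordan_blockX mxE => /eqP; rewrite oner_eq0.
suff: (3 < \rank J)%N.
  by move/leq_trans; apply; rewrite JE (leq_trans (mxrankM_maxl _ _)) //
    mxrankM_maxr.
rewrite /J /= !rank_diag_block_mx mxrank0 addn0.
exact: (leq_add (rank_jordan_block C 3) (rank_jordan_block C 1)).
Qed.

(** * Matrices of the slice in the orbit *)

Lemma slice_pow4_eq0 (B : comNzRingType) (s : 'rV[B]_3) (D : 'M[B]_3) :
    D^T = D -> \tr D + 4 * normsq s = 0 -> s *m D = 0 -> D *m D = \tr D *: D ->
  slice_mx s D *m slice_mx s D *m (slice_mx s D *m slice_mx s D) = 0.
Proof.
move=> D_sym rho0 r0 DD.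
have ul := slice_pow4_ul s D_sym; have ur := slice_pow4_ur s D_sym.
have cross0 : cross_mx 0 = 0 :> 'M[B]_3
  by rewrite -(scale0r 0) cross_mxZ scale0r.
move: ul ur; rewrite r0 rho0 !scale0r subr0 cross0 mulmx0 scaler0 DD subrr
  !add0r.
rewrite big1 => [|i _]; last by rewrite mxE mulr0.
rewrite raddf0 scaler0 oppr0.
rewrite slice_sqr // rho0 subr0 r0 cross0 addr0.
set P := 2 *: _ - D; set N2 := 2 *: cross_mx s; set q2 := 2 * normsq s.
rewrite mulmx_block block_mxKul block_mxKur.
have -> : q2 *: cross_mx s = normsq s *: N2 by rewrite /q2 mulrC -scalerA.
clearbody P N2.
rewrite -!scalemxAl -!scalemxAr => ul ur.
by rewrite ul ur -scalerDr [N2 *m P + _]addrC ur scaler0 addrC ul block_mx0.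
Qed.

Lemma slice_mx_sp (B : comUnitRingType) (s : 'rV[B]_3) (D : 'M[B]_3) :
  D^T = D -> sp (slice_mx s D).
Proof.
move=> D_sym; apply/sp_blockE; split; rewrite ?trmx1 ?tr_cross_mx ?opprK //.
by rewrite linearB /= trmx_mul tr_cross_mx mulmxN mulNmx opprK D_sym.
Qed.

Lemma slice_mx_slice (B : comUnitRingType) (s : 'rV[B]_3) (D : 'M[B]_3) :
  D^T = D -> slice (slice_mx s D).
Proof.
move=> D_sym; exists (cross_mx s), (cross_mx s *m cross_mx s - D); split=> //.
  by rewrite tr_cross_mx subrr.
by rewrite linearB /= trmx_mul tr_cross_mx mulmxN mulNmx opprK D_sym.
Qed.

(** Row and column operations by [- cross_mx s] clear the diagonal blocks. *)
Lemma rank_slice_mx (F : fieldType) (s : 'rV[F]_3) (D : 'M[F]_3) :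
  (3 + \rank D <= \rank (slice_mx s D))%N.
Proof.
pose U : 'M[F]_(3 + 3) := block_mx 1%:M 0 (- cross_mx s) 1%:M.
pose J : 'M[F]_(3 + 3) := block_mx 0 1%:M 1%:M 0.
have : U *m slice_mx s D *m U *m J = block_mx 1%:M 0 0 (- D).
  rewrite /U /J /slice_mx !mulmx_block !(mulmx0, mul0mx, mulmx1, mul1mx, add0r,
    addr0).
  rewrite !mulmxN !mulNmx subrr addNr !mul0mx ?addr0 ?add0r; congr block_mx.
  by rewrite subr0 addKr.
move/(congr1 mxrank); rewrite rank_diag_block_mx mxrank1 mxrank_opp => <-.
apply: leq_trans (mxrankM_maxl _ _) _; apply: leq_trans (mxrankM_maxl _ _) _.
exact: mxrankM_maxr.
Qed.

Lemma tr_mul_row (B : comNzRingType) (s d : 'rV[B]_3) :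
  \tr (d^T *m s) = \sum_i s 0 i * d 0 i.
Proof. by rewrite mxtrace_mulC trace_mx11 mxE; apply: eq_bigr => i _;
  rewrite mxE. Qed.

(** The trace of the upper right block of the cube is [- 4 s.s], and the rank
    is [3 + rank D]; so [s.s] not zero excludes the smaller orbits. *)
Lemma slice_mx_subregular (C : numClosedFieldType) (s d : 'rV[C]_3) :
    4 * normsq s + normsq d = 0 -> s *m d^T = 0 -> normsq s != 0 ->
  subregular (slice_mx s (d^T *m d)).
Proof.
move=> qsd sd qs.
have D_sym : (d^T *m d)^T = d^T *m d by rewrite trmx_mul trmxK.
have trD : \tr (d^T *m d) = normsq d.
  by rewrite tr_mul_row; apply: eq_bigr => i _.
have rho0 : \tr (d^T *m d) + 4 * normsq s = 0 by rewrite trD addrC.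
have r0 : s *m (d^T *m d) = 0 by rewrite mulmxA sd mul0mx.
split.
- exact: slice_mx_sp.
- apply: slice_pow4_eq0 => //.
  rewrite mulmxA -[d^T *m d *m d^T]mulmxA [d *m d^T]mx11_scalar mul_mx_scalar
    -scalemxAl.
  by rewrite mxtrace_mulC [in RHS]trace_mx11.
- apply/eqP => A3; move: qs; rewrite (_ : normsq s = 0) ?eqxx //.
  move/(congr1 (fun A => \tr (ursubmx A))): A3.
  rewrite slice_sqr // r0 rho0 /slice_mx mulmx_block block_mxKur mul1mx.
  rewrite -scalemxAr cross_mx_sqr mxtraceD !(mxtraceD, mxtraceZ,
    linearN) /= trD.
  rewrite mxtrace_scalar tr_mul_row -[\sum_i _]/(normsq s).
  rewrite (_ : ursubmx 0 = 0) ?mxtrace0; last by apply/matrixP => i j;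
    rewrite !mxE.
  rewrite -[normsq d](addKr (4 * normsq s)) qsd addr0 => tr0.
  have /eqP : 4 * normsq s = 0 by rewrite -[RHS]oppr0 -tr0; ring.
  by rewrite mulf_eq0 pnatr_eq0 => /eqP.
apply: leq_trans (rank_slice_mx _ _);
  rewrite -[4%N]/(3 + 1)%N leq_add2l lt0n mxrank_eq0.
apply: contra qs => /eqP D0; move: rho0; rewrite D0 linear0 add0r => /eqP.
by rewrite mulf_eq0 pnatr_eq0.
Qed.

(** * Linear lifts that are multiplicative modulo an ideal *)

Section QuotientMorphism.
Variables (F : comNzRingType) (A : comAlgType F) (I : ideal A).

Lemma quot_pi_zmod : zmod_morphism (quot_pi I).
Proof.
move=> a b; apply/eqP; rewrite eq_sym subr_eq -quot_piD subrK eqxx.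
by [].
Qed.

Lemma quot_pi_monoid : monoid_morphism (quot_pi I).
Proof. by split=> // a b; apply: quot_piM. Qed.

HB.instance Definition _ :=
  GRing.isZmodMorphism.Build A (quot_alg I) (quot_pi I) quot_pi_zmod.
HB.instance Definition _ :=
  GRing.isMonoidMorphism.Build A (quot_alg I) (quot_pi I) quot_pi_monoid.

Lemma quot_pi_eq0 a : quot_pi I a = 0 <-> I a.
Proof. by rewrite -(rmorph0 (quot_pi I)) quot_piP subr0. Qed.

End QuotientMorphism.

Section Substitution.
Variables (F : comNzRingType) (n k : nat).
Implicit Types (q : 'rV[{mpoly F[k]}]_n) (p : {mpoly F[n]}).

Definition subst q p : {mpoly F[k]} := mmap (@mpolyC k F) (fun i => q 0 i) p.

HB.instance Definition _ q := GRing.RMorphism.copy (subst q)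
  (mmap (@mpolyC k F) (fun i => q 0 i)).

Lemma substX q i : subst q 'X_i = q 0 i.
Proof. by rewrite /subst mmapX mmap1U. Qed.

Lemma substC q c : subst q c%:MP = c%:MP.
Proof. exact: mmapC. Qed.

Lemma substZ q : scalable (subst q).
Proof. by move=> c p; rewrite /subst mmapZ mul_mpolyC. Qed.

Lemma peval_subst q p v : peval (subst q p) v = peval p (map_mx (fun r =>
  peval r v) q).
Proof.
rewrite /peval; elim/mpoly_ring_ind: p => [c|p1 p2 IH1 IH2|p1 p2 IH1 IH2|i].
- by rewrite substC !mevalC.
- by rewrite rmorphD !mevalD IH1 IH2.
- by rewrite rmorphM !mevalM IH1 IH2.
- by rewrite substX mevalXU mxE.
Qed.

End Substitution.

Section Semilinear.
Variables (F : comNzRingType) (n : nat) (A : comAlgType F) (Q : comPzRingType).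
Variables (g : {rmorphism A -> Q}) (L : {linear {mpoly F[n]} -> A}).

(** L need not be multiplicative, but modulo the kernel of g it may turn the
    multiplication by b into that by a. The pairs (b, a) for which it does
    are closed under ring operations, so this can be checked on generators. *)
Definition acts_as (b : {mpoly F[n]}) (a : A) : Prop :=
  forall r, g (L (r * b)) = g (L r) * g a.

Lemma acts_asC c : acts_as c%:MP c%:A.
Proof.
move=> r; rewrite mulrC mul_mpolyC linearZ /= -[L r in LHS]mul1r scalerAl
  rmorphM.
exact: mulrC.
Qed.

Lemma acts_asD b b' a a' : acts_as b a -> acts_as b' a' ->
  acts_as (b + b') (a + a').
Proof. by move=> ba ba' r; rewrite mulrDr linearD !rmorphD /= ba ba' mulrDr.
  Qed.

Lemma acts_asM b b' a a' : acts_as b a -> acts_as b' a' ->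
  acts_as (b * b') (a * a').
Proof. by move=> ba ba' r; rewrite mulrA ba' ba rmorphM mulrA. Qed.

Lemma acts_as0 : acts_as 0 0.
Proof. by rewrite -(mpolyC0 n) -(scale0r 1); apply: acts_asC. Qed.

Lemma acts_as1 : acts_as 1 1.
Proof. by move=> r; rewrite rmorph1 !mulr1. Qed.

Lemma acts_asN b a : acts_as b a -> acts_as (- b) (- a).
Proof. by move=> ba r; rewrite mulrN linearN !rmorphN /= ba mulrN. Qed.

Lemma acts_asB b b' a a' : acts_as b a -> acts_as b' a' ->
  acts_as (b - b') (a - a').
Proof. by move=> ba /acts_asN; apply: acts_asD. Qed.

Lemma acts_as_nat k : acts_as k%:R k%:R.
Proof. by elim: k => [|k IH]; [exact: acts_as0 | rewrite !mulrS;
  apply: acts_asD IH; exact: acts_as1]. Qed.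

Lemma acts_as_sum (I : finType) (b : I -> {mpoly F[n]}) (a : I -> A) :
  (forall i, acts_as (b i) (a i)) -> acts_as (\sum_i b i) (\sum_i a i).
Proof.
by move=> ba; elim/big_rec2: _ => [|i *]; [exact: acts_as0 | exact: acts_asD].
Qed.

Lemma acts_as_eq b a a' : acts_as b a -> g a = g a' -> acts_as b a'.
Proof. by move=> ba eq_a r; rewrite ba eq_a. Qed.

Lemma acts_as_subst k (q : 'rV[{mpoly F[n]}]_k) (h :
  {rmorphism {mpoly F[k]} -> A}) :
    (forall c, h c%:MP = c%:A) -> (forall i, acts_as (q 0 i) (h 'X_i)) ->
  forall p, acts_as (subst q p) (h p).
Proof.
move=> hC hX; elim/mpoly_ring_ind => [c|p1 p2 IH1 IH2|p1 p2 IH1 IH2|i].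
- by rewrite substC hC; apply: acts_asC.
- by rewrite !rmorphD; apply: acts_asD.
- by rewrite !rmorphM; apply: acts_asM.
- by rewrite substX.
Qed.

End Semilinear.

(** By linearity it is enough to compare the values of E. *)
Lemma acts_as_mlift (F : comNzRingType) n (A : comAlgType F) (Q : comPzRingType)
    (g : {rmorphism A -> Q}) (E : 'X_{1..n} -> A) (m : 'X_{1..n}) (a : A) :
    (forall m', g (E (m' + m)%MM) = g (E m') * g a) ->
  acts_as g (mlift E) 'X_[m] a.
Proof.
move=> Em r; elim/mpoly_lin_ind: r => [|c p1 p2 IH1 IH2|m'].
- by rewrite mul0r !linear0 !rmorph0 mul0r.
- rewrite mulrDl -scalerAl !linearP !rmorphD /= IH2 mulrDl.
  congr (_ + _); rewrite -[mlift E _ in LHS]mul1r -[mlift E p1]mul1r !scalerAl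
    !rmorphM.
  by rewrite IH1 mulrA.
by rewrite /= -mpolyXD !mliftX.
Qed.

(** * Lifts along the products of two coordinates *)

Lemma rshift_notin_codom n k (i : 'I_k) : rshift n i \notin codom (@lshift n k).
Proof. by apply/codomP => -[j /eqP]; rewrite eq_rlshift. Qed.

Lemma lshift_notin_codom n k (i : 'I_n) : lshift k i \notin codom (@rshift n k).
Proof. by apply/codomP => -[j /eqP]; rewrite eq_lrshift. Qed.

Lemma mseq_in2 n k (h : 'I_k -> 'I_n) (m : 'X_{1..n}) i j : injective h ->
  perm_eq (mseq h (m + (U_(h i) + U_(h j)))) [:: i, j & mseq h m].
Proof.
move=> h_inj; rewrite [(U_(_) + _)%MM]addmC addmA.
by rewrite (perm_trans (mseq_in _ _ _)) // perm_cons mseq_in.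
Qed.

Lemma mseq_out2 n k (h : 'I_k -> 'I_n) (m : 'X_{1..n}) i j :
  i \notin codom h -> j \notin codom h ->
    mseq h (m + (U_(i) + U_(j))) = mseq h m.
Proof. by move=> ih jh; rewrite addmA !mseq_out. Qed.

Section SliceLift.
Variables (F : comNzRingType) (A : comAlgType F) (s : 'rV[A]_3) (D : 'M[A]_3).

(** A monomial in (s, d).  The slice only knows the products d_i d_j, so the
    factors of d are lifted in pairs. *)
Definition slice_lift_mnm (m : 'X_{1..3 + 3}) : A :=
  (\prod_i s 0 i ^+ m (lshift 3 i)) * pairprod D (mseq (@rshift 3 3) m).

Definition slice_lift : {mpoly F[3 + 3]} -> A := mlift slice_lift_mnm.

HB.instance Definition _ := GRing.Linear.copy slice_lift (mlift slice_lift_mnm).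

Lemma slice_lift1 : slice_lift 1 = 1.
Proof.
rewrite -mpolyX0 /slice_lift mliftX /slice_lift_mnm big1 => [|i _];
  last by rewrite mnm0E expr0.
rewrite mul1r; suff -> : mseq (@rshift 3 3) 0 = [::] by [].
by apply/perm_nilP; apply: mseqP => i; rewrite mnm0E.
Qed.

Section Acts.
Variables (Q : comPzRingType) (g : {rmorphism A -> Q}).
Hypothesis D_sym : forall i j, g (D i j) = g (D j i).
Hypothesis D_exch : forall i j k l, g (D i j) * g (D k l) = g (D i k) * g (D j
  l).

Lemma slice_lift_s i : acts_as g slice_lift 'X_(lshift 3 i) (s 0 i).
Proof.
apply: acts_as_mlift => m; rewrite -rmorphM /slice_lift_mnm mseq_out
  ?lshift_notin_codom //.
rewrite mulrAC; congr (g (_ * _)).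
rewrite (bigD1 i) //= [in RHS](bigD1 i) //= mnmDE mnm1E eqxx addn1 exprSr
  mulrAC.
congr (_ * _ * _); apply: eq_bigr => j ne.
by rewrite mnmDE mnm1E (inj_eq (@lshift_inj _ _)) eq_sym (negPf ne) addn0.
Qed.

Lemma slice_lift_dd i j :
  acts_as g slice_lift ('X_(rshift 3 i) * 'X_(rshift 3 j)) (D i j).
Proof.
rewrite -mpolyXD; apply: acts_as_mlift => m.
rewrite /slice_lift_mnm !rmorphM !pairprod_rmorph /= -mulrA; congr (_ * _).
  congr (g _); apply: eq_bigr => k _.
  by rewrite !mnmDE !mnm1E !eq_rlshift !addn0.
rewrite (pairprod_perm D_sym D_exch (mseq_in2 _ _ _ (@rshift_inj _ _))) /=.
exact: mulrC.
Qed.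

(** The product of s.d with a monomial even in d is odd in d, hence lifts to
    0; a monomial odd in d has a factor d_j, and (s.d) d_j lifts to
    [(s D)_j]. *)
Lemma slice_lift_sd : (forall j, g (\sum_i s 0 i * D i j) = 0) ->
  acts_as g slice_lift (\sum_i 'X_(lshift 3 i) * 'X_(rshift 3 i)) 0.
Proof.
move=> sD0 r; rewrite rmorph0 mulr0.
elim/mpoly_lin_ind: r => [|c p1 p2 IH1 IH2|m].
- by rewrite mul0r linear0 rmorph0.
- rewrite mulrDl -scalerAl linearP /= rmorphD IH2 addr0.
  by rewrite -[slice_lift _]mul1r scalerAl rmorphM IH1 mulr0.
case E: (mseq (@rshift 3 3) m) => [|j l].
  rewrite mulr_sumr linear_sum rmorph_sum big1 //= => i _.
  rewrite mulrA -!mpolyXD /slice_lift mliftX /slice_lift_mnm.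
  rewrite (@pairprod_odd _ _ _ (mseq _ _)) ?mulr0 ?rmorph0 //.
  rewrite (perm_size (mseq_in (@rshift_inj _ _) _ _)) /=.
  by rewrite mseq_out ?lshift_notin_codom // E.
have [m' ->] : exists m', m = (m' + U_(rshift 3 j))%MM
  by apply: mseq_gt0; rewrite E mem_head.
rewrite mpolyXD -mulrA.
have := @acts_as_sum _ _ _ _ g slice_lift _
  (fun i => 'X_(lshift 3 i) * ('X_(rshift 3 i) * 'X_(rshift 3 j)))
  (fun i => s 0 i * D i j) (fun i => acts_asM (slice_lift_s i) (slice_lift_dd i
    j)).
move=> /(_ 'X_[m']); rewrite sD0 mulr0 => <-; congr (g (slice_lift (_ * _))).
by rewrite mulr_sumr; apply: eq_bigr => i _; ring.
Qed.

Lemma slice_lift_entry (i j : 'I_(3 + 3)) (sg := \row_i 'X_(lshift 3 i))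
    (dg := \row_i 'X_(rshift 3 i) : 'rV[{mpoly F[3 + 3]}]_3) :
  acts_as g slice_lift (slice_mx sg (dg^T *m dg) i j) (slice_mx s D i j).
Proof.
have cross a b : acts_as g slice_lift (cross_mx sg a b) (cross_mx s a b).
  move: a b; elim/forall_ord3; elim/forall_ord3; rewrite !mxE /=;
    rewrite ?mxE;
    first [exact: acts_as0 | exact: slice_lift_s | apply: acts_asN;
      exact: slice_lift_s].
rewrite -(splitK i) -(splitK j).
case: (split i) (split j) => a [] b /=;
  rewrite ?(block_mxEul, block_mxEur, block_mxEdl, block_mxEdr) //.
  by rewrite !mxE; case: eqP => _; [exact: acts_as1 | exact: acts_as0].
rewrite [X in acts_as _ _ X]mxE [X in acts_as _ _ _ X]mxE !mxE big_ord1 !mxE.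
apply: acts_asD; first by apply: acts_as_sum => k; apply: acts_asM;
  apply: cross.
by apply: acts_asN; apply: slice_lift_dd.
Qed.

End Acts.

(** The lift forgets the part odd in d: it averages over d and - d. *)
Lemma slice_lift_eval (e : {rmorphism A -> F}) (z d : 'rV[F]_3) :
    (forall c, e c%:A = c) ->
    (forall i, e (s 0 i) = z 0 i) -> (forall i j, e (D i j) = d 0 i * d 0 j) ->
  forall p, e (slice_lift p) *+ 2 =
    peval p (row_mx z d) + peval p (row_mx z (- d)).
Proof.
move=> eC es eD; elim/mpoly_lin_ind => [|c p1 p2 IH1 IH2|m].
- by rewrite !linear0 /peval !meval0 rmorph0 mul0rn addr0.
- rewrite linearP /= rmorphD mulrnDl IH2 -[slice_lift p1]mul1r scalerAl rmorphM
    eC.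
  rewrite -mulrnAr IH1 /peval !mevalD !mevalZ; ring.
have pevalX (w : 'rV[F]_3) : peval 'X_[m] (row_mx z w) =
    (\prod_i z 0 i ^+ m (lshift 3 i)) * \prod_(i <- mseq (@rshift 3 3) m) w 0 i.
  rewrite /peval mevalX big_split_ord /= prod_mseq; congr (_ * _);
    apply: eq_bigr => i _.
    by rewrite row_mxEl.
  by rewrite row_mxEr.
rewrite !pevalX -mulrDr /slice_lift mliftX /slice_lift_mnm rmorphM -mulrnAr.
congr (_ * _); first by rewrite rmorph_prod; apply: eq_bigr => i _;
  rewrite rmorphXn /= es.
rewrite pairprod_rmorph.
have -> : pairprod (fun i j => e (D i j)) = pairprod (fun i j => d 0 i * d 0 j).
  by congr pairprod; apply/funext => i; apply/funext => j.
rewrite pairprod_rank1; congr (_ + _); apply: eq_bigr => i _.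
by rewrite mxE.
Qed.

End SliceLift.

Section DoubleLift.
Variables (F : comNzRingType) (A : comAlgType F) (U V : 'I_2 -> 'I_2 -> A).

(** A monomial in (x, y).  The signs of x and of y change independently, so the
    factors of x and those of y are paired separately. *)
Definition double_lift_mnm (m : 'X_{1..2 + 2}) : A :=
  pairprod U (mseq (@lshift 2 2) m) * pairprod V (mseq (@rshift 2 2) m).

Definition double_lift : {mpoly F[2 + 2]} -> A := mlift double_lift_mnm.

HB.instance Definition _ := GRing.Linear.copy double_lift (mlift
  double_lift_mnm).

Lemma double_lift1 : double_lift 1 = 1.
Proof.
rewrite -mpolyX0 /double_lift mliftX /double_lift_mnm.
have mseq0 (h : 'I_2 -> 'I_(2 + 2)) : mseq h 0 = [::].
  by apply/perm_nilP; apply: mseqP => i; rewrite mnm0E.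
by rewrite !mseq0 mulr1.
Qed.

Section Acts.
Variables (Q : comPzRingType) (g : {rmorphism A -> Q}).
Hypothesis U_sym : forall i j, g (U i j) = g (U j i).
Hypothesis U_exch : forall i j k l, g (U i j) * g (U k l) = g (U i k) * g (U j
  l).
Hypothesis V_sym : forall i j, g (V i j) = g (V j i).
Hypothesis V_exch : forall i j k l, g (V i j) * g (V k l) = g (V i k) * g (V j
  l).

Lemma double_lift_xx i j :
  acts_as g double_lift ('X_(lshift 2 i) * 'X_(lshift 2 j)) (U i j).
Proof.
rewrite -mpolyXD; apply: acts_as_mlift => m.
rewrite /double_lift_mnm !rmorphM !pairprod_rmorph //=.
rewrite (pairprod_perm U_sym U_exch (mseq_in2 _ _ _ (@lshift_inj _ _))) /=.
rewrite mseq_out2 ?lshift_notin_codom //.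
by rewrite -mulrA mulrC.
Qed.

Lemma double_lift_yy i j :
  acts_as g double_lift ('X_(rshift 2 i) * 'X_(rshift 2 j)) (V i j).
Proof.
rewrite -mpolyXD; apply: acts_as_mlift => m.
rewrite /double_lift_mnm !rmorphM !pairprod_rmorph //=.
rewrite (pairprod_perm V_sym V_exch (mseq_in2 _ _ _ (@rshift_inj _ _))) /=.
rewrite mseq_out2 ?rshift_notin_codom //.
by rewrite -mulrA; congr (_ * _); rewrite mulrC.
Qed.

End Acts.

(** The lift averages over the signs of x and of y. *)
Lemma double_lift_eval (e : {rmorphism A -> F}) (x y : 'rV[F]_2) :
    (forall c, e c%:A = c) ->
    (forall i j, e (U i j) = x 0 i * x 0 j) ->
    (forall i j, e (V i j) = y 0 i * y 0 j) ->
  forall p, e (double_lift p) *+ 4 =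
    peval p (row_mx x y) + peval p (row_mx (- x) y) +
    peval p (row_mx x (- y)) + peval p (row_mx (- x) (- y)).
Proof.
move=> eC eU eV; elim/mpoly_lin_ind => [|c p1 p2 IH1 IH2|m].
- by rewrite !linear0 /peval !meval0 rmorph0 mul0rn !addr0.
- rewrite linearP /= rmorphD mulrnDl IH2 -[double_lift p1]mul1r scalerAl rmorphM
    eC.
  rewrite -mulrnAr IH1 /peval !mevalD !mevalZ; ring.
have pevalX (v w : 'rV[F]_2) : peval 'X_[m] (row_mx v w) =
    (\prod_(i <- mseq (@lshift 2 2) m) v 0 i) * \prod_(i <- mseq (@rshift 2 2)
      m) w 0 i.
  rewrite /peval mevalX big_split_ord /= !prod_mseq.
  by congr (_ * _); apply: eq_bigr => i _; rewrite ?row_mxEl ?row_mxEr.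
rewrite !pevalX /double_lift mliftX /double_lift_mnm rmorphM !pairprod_rmorph.
have -> : (fun i j => e (U i j)) = (fun i j => x 0 i * x 0 j).
  by apply/funext => i; apply/funext => j.
have -> : (fun i j => e (V i j)) = (fun i j => y 0 i * y 0 j).
  by apply/funext => i; apply/funext => j.
rewrite -[4%N]/(2 * 2)%N mulrnA -mulrnAl -mulrnAr !pairprod_rank1.
have prodN (z : 'rV[F]_2) l : \prod_(i <- l) (- z) 0 i = \prod_(i <- l) - z 0 i.
  by apply: eq_bigr => i _; rewrite mxE.
by rewrite !prodN; ring.
Qed.

End DoubleLift.

(** * The cone of isotropic vectors *)

Local Notation j0 := (@Ordinal 2 0 isT).
Local Notation j1 := (@Ordinal 2 1 isT).

Lemma forall_ord2 (P : 'I_2 -> Prop) : P j0 -> P j1 -> forall i, P i.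
Proof. by move=> P0 P1 [[|[|//]] lt_i];
  rewrite (bool_irrelevance lt_i isT). Qed.

Section Conic.
Variables (B : comNzRingType) (c h : B).

(** A linear change of coordinates from symmetric 2x2 matrices to vectors,
    under which [4 det U] is [- normsq]; c is a square root of -1. *)
Definition cone_of_squares (U : 'I_2 -> 'I_2 -> B) : 'rV[B]_3 :=
  \row_i nth 0 [:: U j0 j0 - U j1 j1; c * (U j0 j0 + U j1 j1); 2 * U j0 j1] i.

Definition conic (x : 'rV[B]_2) : 'rV[B]_3 := cone_of_squares (fun i j =>
  x 0 i * x 0 j).

(** The inverse change of coordinates; h is one half. *)
Definition conic_inv (u : 'rV[B]_3) (i j : 'I_2) : B :=
  if i != j then h * u 0 i2
  else if i == j0 then h * (u 0 i0 - c * u 0 i1)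
  else - h * (u 0 i0 + c * u 0 i1).

Hypotheses (c2 : c ^+ 2 = -1) (h2 : 2 * h = 1).

Lemma conic_invK u : cone_of_squares (conic_inv u) = u.
Proof.
have hE y : y = (2 * h) * y by rewrite h2 mul1r.
apply/rowP; elim/forall_ord3; rewrite mxE /conic_inv /= [RHS]hE; try ring.
transitivity (- c ^+ 2 * (2 * h * u 0 i1)); [ring | by rewrite c2; ring].
Qed.

Lemma conicK x i j : conic_inv (conic x) i j = x 0 i * x 0 j.
Proof.
have hE y : y = (2 * h) * y by rewrite h2 mul1r.
move: i j; elim/forall_ord2; elim/forall_ord2; rewrite /conic_inv /= !mxE /=.
- transitivity (h * ((1 - c ^+ 2) * x 0 j0 ^+ 2 - (1 + c ^+ 2) * x 0 j1 ^+ 2));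
    first by ring.
  by rewrite c2 [RHS]hE; ring.
- by rewrite [RHS]hE; ring.
- by rewrite [RHS]hE; ring.
- transitivity (h * ((1 - c ^+ 2) * x 0 j1 ^+ 2 - (1 + c ^+ 2) * x 0 j0 ^+ 2));
    first by ring.
  by rewrite c2 [RHS]hE; ring.
Qed.

Lemma conic_inv_sym u i j : conic_inv u i j = conic_inv u j i.
Proof. by move: i j; elim/forall_ord2; elim/forall_ord2. Qed.

(** The only 2x2 minor is the determinant, which is [- h^2 normsq u]. *)
Lemma conic_inv_exch (I : ideal B) u : I (normsq u) -> forall i j k l,
  I (conic_inv u i j * conic_inv u k l - conic_inv u i k * conic_inv u j l).
Proof.
move=> Iu; have det : I (conic_inv u j0 j0 * conic_inv u j1 j1 - conic_inv u j0
  j1 ^+ 2).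
  rewrite [X in I X](_ : _ = - h ^+ 2 * normsq u); first exact: idealM.
  rewrite /conic_inv /= /normsq sum_ord3.
  transitivity (- h ^+ 2 * (u 0 i0 ^+ 2 - c ^+ 2 * u 0 i1 ^+ 2 + u 0 i2 ^+ 2));
    first by ring.
  by rewrite c2; ring.
elim/forall_ord2; elim/forall_ord2; elim/forall_ord2; elim/forall_ord2;
  rewrite ?(conic_inv_sym u j1 j0);
  first [ by rewrite subrr; exact: ideal0 | by rewrite mulrC subrr;
    exact: ideal0
        | exact: det | by rewrite -opprB; apply: idealN
        | by rewrite mulrC; exact: det | by rewrite -opprB [X in X - _]mulrC;
          apply/idealN/det].
Qed.

Lemma conic_normsq x : normsq (conic x) = 0.
Proof.
rewrite /normsq sum_ord3 !mxE /=.
transitivity ((x 0 j0 ^+ 2 - x 0 j1 ^+ 2) ^+ 2 + c ^+ 2 * (x 0 j0 ^+ 2 + x 0 j1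
  ^+ 2) ^+ 2
  + 4 * (x 0 j0 * x 0 j1) ^+ 2); first by ring.
by rewrite c2; ring.
Qed.

End Conic.

(** * Coordinates on the slice and its parametrization *)

Section SliceCoordinates.
Variable B : comNzRingType.
Implicit Types (A : 'M[B]_(3 + 3)).

Definition slice_s A : 'rV[B]_3 :=
  \row_i nth 0 [:: ulsubmx A i2 i1; ulsubmx A i0 i2; ulsubmx A i1 i0] i.

(** Only the upper triangle of [N^2 - Z2] is read, which makes the result
    symmetric for every A, in particular for the matrix of variables. *)
Definition slice_D A : 'M[B]_3 :=
  let E := cross_mx (slice_s A) *m cross_mx (slice_s A) - dlsubmx A in
  \matrix_(i, j) if (i <= j)%N then E i j else E j i.

Lemma tr_slice_D A : (slice_D A)^T = slice_D A.
Proof.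
by apply/matrixP => i j; rewrite !mxE; case: (ltngtP i j) => // ij;
  rewrite (val_inj ij).
Qed.

Lemma slice_sK s D : slice_s (slice_mx s D) = s.
Proof. by apply/rowP; elim/forall_ord3; rewrite mxE /= block_mxKul mxE. Qed.

Lemma slice_DK s D : D^T = D -> slice_D (slice_mx s D) = D.
Proof.
move=> D_sym; rewrite /slice_D slice_sK block_mxKdl opprB addrC subrK.
by apply/matrixP => i j; rewrite mxE -[in X in if _ then _ else X]D_sym mxE
  if_same.
Qed.

End SliceCoordinates.

Lemma slice_mxK (F : comUnitRingType) (A : 'M[F]_(3 + 3)) : slice A ->
  (forall a : F, a *+ 2 = 0 -> a = 0) ->
  slice_mx (slice_s A) (slice_D A) = A.
Proof.
move=> [Z1 [Z2 [/eqP skew_Z1 sym_Z2 ->]]] char2; set A' := block_mx _ _ _ _.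
have Z1E : cross_mx (slice_s A') = Z1.
  have asym i j : Z1 i j = - Z1 j i.
    by move: skew_Z1; rewrite addr_eq0 => /eqP e; rewrite {1}e !mxE.
  have diag i : Z1 i i = 0 by apply: char2; rewrite mulr2n {1}asym addNr.
  apply/matrixP; elim/forall_ord3; elim/forall_ord3;
    rewrite /slice_s block_mxKul !mxE /= ?diag // ?mxE //= -?asym //.
rewrite /slice_mx Z1E /A'; congr block_mx.
rewrite /slice_D Z1E block_mxKdl.
have Z1_T : Z1^T = - Z1 by apply/eqP; rewrite -addr_eq0 addrC.
suff -> : (\matrix_(i, j) (if (i <= j)%N then (Z1 *m Z1 - Z2) i j else (Z1 *m Z1
  - Z2) j i)) = Z1 *m Z1 - Z2.
  by rewrite opprB addrC subrK.
have sym : (Z1 *m Z1 - Z2)^T = Z1 *m Z1 - Z2.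
  by rewrite linearB /= trmx_mul Z1_T mulmxN mulNmx opprK -sym_Z2.
apply/matrixP => i j; rewrite mxE; case: ifP => // _; by rewrite -{1}sym mxE.
Qed.

(** The point (s, d) of the isotropic vectors [u = conic c x] and
    [v = conic c y]: as [s = u + v] and [d = 2 (u - v)], both [s.d] and
    [4 s.s + d.d] vanish. *)
Definition sd_of_xy (B : comNzRingType) (c : B) (x y : 'rV[B]_2) :
  'rV[B]_(3 + 3) :=
  row_mx (conic c x + conic c y) (2 *: (conic c x - conic c y)).

Section Naturality.
Variables (B B' : comNzRingType) (f : {rmorphism B -> B'}).

Lemma map_cross_mx s : map_mx f (cross_mx s) = cross_mx (map_mx f s).
Proof.
by apply/matrixP; elim/forall_ord3; elim/forall_ord3;
  rewrite !mxE /= ?mxE ?rmorph0 ?rmorphN.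
Qed.

Lemma map_slice_mx s D : map_mx f (slice_mx s D) = slice_mx (map_mx f s) (map_mx
  f D).
Proof. by rewrite /slice_mx map_block_mx map_mxB map_mxM map_cross_mx map_mx1.
  Qed.

Lemma map_slice_s A : map_mx f (slice_s A) = slice_s (map_mx f A).
Proof. by apply/rowP; elim/forall_ord3; rewrite !mxE /= ?mxE. Qed.

Lemma map_slice_D A : map_mx f (slice_D A) = slice_D (map_mx f A).
Proof.
rewrite /slice_D -map_slice_s -map_cross_mx -map_mxM -map_dlsubmx -map_mxB.
by apply/matrixP => i j; rewrite !mxE; case: ifP; rewrite ?mxE.
Qed.

Lemma map_conic c x : map_mx f (conic c x) = conic (f c) (map_mx f x).
Proof.
apply/rowP; elim/forall_ord3; rewrite !mxE /= ?mxE;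
  by rewrite !(mxE, rmorphB, rmorphD, rmorphM) ?rmorph1.
Qed.

Lemma map_xy_coords c x y :
  map_mx f (sd_of_xy c x y) = sd_of_xy (f c) (map_mx f x) (map_mx f y).
Proof.
by rewrite map_row_mx map_mxZ map_mxD map_mxB !map_conic rmorph_nat.
Qed.

End Naturality.

Section Model.
Variable C : numClosedFieldType.
Local Notation mpM := {mpoly C[(3 + 3) * (3 + 3)]}.
Local Notation mpS := {mpoly C[3 + 3]}.
Local Notation mpW := {mpoly C[2 + 2]}.

Definition generic_mx : 'M[mpM]_(3 + 3) := vec_mx (\row_k 'X_k).
Definition sgen : 'rV[mpS]_3 := \row_i 'X_(lshift 3 i).
Definition dgen : 'rV[mpS]_3 := \row_i 'X_(rshift 3 i).
Definition xgen : 'rV[mpW]_2 := \row_i 'X_(lshift 2 i).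
Definition ygen : 'rV[mpW]_2 := \row_i 'X_(rshift 2 i).

Definition sd_pullback : mpM -> mpS := subst (mxvec (slice_mx sgen (dgen^T *m
  dgen))).
Definition xy_pullback : mpS -> mpW := subst (sd_of_xy ('i%:MP) xgen ygen).

HB.instance Definition _ := GRing.RMorphism.copy sd_pullback
  (subst (mxvec (slice_mx sgen (dgen^T *m dgen)))).
HB.instance Definition _ := GRing.RMorphism.copy xy_pullback
  (subst (sd_of_xy ('i%:MP) xgen ygen)).

Definition wreath_mx (x y : 'rV[C]_2) : 'M[C]_(3 + 3) :=
  let d := 2 *: (conic 'i x - conic 'i y) in
  slice_mx (conic 'i x + conic 'i y) (d^T *m d).

Lemma peval_generic_mx v : map_mx (fun p => peval p v) generic_mx = vec_mx v.
Proof. by apply/matrixP => i j; rewrite !mxE /peval mevalXU. Qed.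

Lemma map_peval n k m (M : 'M[{mpoly C[n]}]_(k, m)) v :
  map_mx (fun p => peval p v) M = map_mx (meval (v 0)) M.
Proof. by apply/matrixP => i j; rewrite !mxE. Qed.

Lemma peval_sd (p : mpM) s d :
  peval (sd_pullback p) (row_mx s d) = peval p (mxvec (slice_mx s (d^T *m d))).
Proof.
rewrite peval_subst; congr (peval p).
rewrite map_peval map_mxvec; congr mxvec.
have es : map_mx (meval (row_mx s d 0)) sgen = s.
  by apply/rowP => i; rewrite !mxE mevalXU row_mxEl.
have ed : map_mx (meval (row_mx s d 0)) dgen = d.
  by apply/rowP => i; rewrite !mxE mevalXU row_mxEr.
by rewrite map_slice_mx map_mxM -map_trmx es ed.
Qed.

Lemma peval_xy (p : mpS) x y :
  peval (xy_pullback p) (row_mx x y) = peval p (sd_of_xy 'i x y).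
Proof.
rewrite peval_subst; congr (peval p).
have ex : map_mx (meval (row_mx x y 0)) xgen = x.
  by apply/rowP => i; rewrite !mxE mevalXU row_mxEl.
have ey : map_mx (meval (row_mx x y 0)) ygen = y.
  by apply/rowP => i; rewrite !mxE mevalXU row_mxEr.
by rewrite map_peval map_xy_coords ex ey; congr sd_of_xy; exact: mevalC.
Qed.

Lemma peval_wreath (p : mpM) x y :
  peval (xy_pullback (sd_pullback p)) (row_mx x y) = peval p (mxvec (wreath_mx x
    y)).
Proof. by rewrite peval_xy peval_sd. Qed.

End Model.

(** * The kernel of the pullback *)

Lemma acts_as_inj (F : comNzRingType) n (A : comAlgType F) (Q : comPzRingType)
    (g : {rmorphism A -> Q}) (L : {linear {mpoly F[n]} -> A}) b a a' :
  L 1 = 1 -> acts_as g L b a -> acts_as g L b a' -> g a = g a'.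
Proof.
by move=> L1 ba ba'; move: (ba 1); rewrite ba' L1 rmorph1 !mul1r.
Qed.

Section Annihilator.
Variables (F : comNzRingType) (n : nat) (A : comAlgType F) (Q : comPzRingType).
Variables (g : {rmorphism A -> Q}) (L : {linear {mpoly F[n]} -> A}).

Lemma acts_as0D a b : acts_as g L a 0 -> acts_as g L b 0 ->
  acts_as g L (a + b) 0.
Proof. by move=> a0 b0 r; rewrite mulrDr linearD rmorphD /= a0 b0 rmorph0 mulr0
  addr0. Qed.

Lemma acts_as0M a b : acts_as g L b 0 -> acts_as g L (a * b) 0.
Proof. by move=> b0 r; rewrite mulrA b0 rmorph0 !mulr0. Qed.

(** The relations that L respects: L induces a map on the quotient by them. *)
Definition annihilator : ideal {mpoly F[n]} :=
  @Ideal _ (fun b => acts_as g L b 0) (acts_as0 g L) acts_as0D acts_as0M.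

End Annihilator.

Section Relations.
Variable C : numClosedFieldType.
Variables (A : comAlgType C) (Q : comPzRingType) (g : {rmorphism A -> Q}).
Variables (s : 'rV[A]_3) (D : 'M[A]_3).
Hypothesis D_sym : forall i j, g (D i j) = g (D j i).
Hypothesis D_exch : forall i j k l, g (D i j) * g (D k l) = g (D i k) * g (D j
  l).
Hypothesis sD : forall j, g (\sum_i s 0 i * D i j) = 0.
Hypothesis tr_D : g (4 * normsq s + \tr D) = 0.

Let L : {linear {mpoly C[3 + 3]} -> A} := slice_lift s D.
Let K := annihilator g L.
Local Notation sg := (sgen C).
Local Notation dg := (dgen C).

Lemma annihilator_sd : K (\sum_i sg 0 i * dg 0 i).
Proof.
rewrite (eq_bigr (fun i => 'X_(lshift 3 i) * 'X_(rshift 3 i))) => [|i _];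
  last by rewrite !mxE.
exact: slice_lift_sd D_sym D_exch sD.
Qed.

Lemma annihilator_norm : K (4 * normsq sg + normsq dg).
Proof.
apply: (@acts_as_eq _ _ _ _ _ _ _ (4 * normsq s + \tr D));
  last by rewrite tr_D rmorph0.
apply: acts_asD; first apply: acts_asM; first exact: acts_as_nat.
  by apply: acts_as_sum => i; rewrite !expr2 !mxE; apply: acts_asM;
    apply: slice_lift_s.
by apply: acts_as_sum => i; rewrite expr2 !mxE; apply: slice_lift_dd.
Qed.

(* u and v recover the two isotropic vectors from (s, d), as in [sd_of_xy]. *)
Let c : {mpoly C[3 + 3]} := 'i%:MP.
Let h : {mpoly C[3 + 3]} := (2^-1)%:MP.
Let q : {mpoly C[3 + 3]} := (4^-1)%:MP.
Let u := q *: (2 *: sg + dg).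
Let v := q *: (2 *: sg - dg).

Let c2 : c ^+ 2 = -1.
Proof. by rewrite /c -rmorphXn /= sqrCi rmorphN1. Qed.

Let h2 : 2 * h = 1.
Proof. by rewrite /h -(rmorph_nat (@mpolyC _ _) 2) -rmorphM /= mulfV ?rmorph1 //
  pnatr_eq0. Qed.

Let q4 : 4 * q = 1.
Proof. by rewrite /q -(rmorph_nat (@mpolyC _ _) 4) -rmorphM /= mulfV ?rmorph1 //
  pnatr_eq0. Qed.

Let Ku : K (normsq u).
Proof.
have -> : normsq u = q ^+ 2 * ((4 * normsq sg + normsq dg) + 4 * \sum_i sg 0 i *
  dg 0 i).
  by rewrite /normsq !sum_ord3 !mxE; ring.
apply/idealM/idealD; [exact: annihilator_norm | apply/idealM;
  exact: annihilator_sd].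
Qed.

Let Kv : K (normsq v).
Proof.
have -> : normsq v = q ^+ 2 * ((4 * normsq sg + normsq dg) - 4 * \sum_i sg 0 i *
  dg 0 i).
  by rewrite /normsq !sum_ord3 !mxE; ring.
apply/idealM/idealB; [exact: annihilator_norm | apply/idealM;
  exact: annihilator_sd].
Qed.

Let g1 : {rmorphism {mpoly C[3 + 3]} -> quot_alg K} := quot_pi K.
Let L1 : {linear {mpoly C[2 + 2]} -> {mpoly C[3 + 3]}} :=
  double_lift (conic_inv c h u) (conic_inv c h v).

Lemma xy_pullback_acts p : acts_as g1 L1 (xy_pullback p) p.
Proof.
have U_sym i j : g1 (conic_inv c h u i j) = g1 (conic_inv c h u j i)
  by rewrite conic_inv_sym.
have V_sym i j : g1 (conic_inv c h v i j) = g1 (conic_inv c h v j i)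
  by rewrite conic_inv_sym.
have exch w : K (normsq w) -> forall i j k l,
  g1 (conic_inv c h w i j) * g1 (conic_inv c h w k l) =
    g1 (conic_inv c h w i k) * g1 (conic_inv c h w j l).
  move=> Kw i j k l; rewrite -!rmorphM; apply/quot_piP; exact: conic_inv_exch.
have act_xx := double_lift_xx _ U_sym (exch _ Ku).
have act_yy := double_lift_yy _ V_sym (exch _ Kv).
have act_c : acts_as g1 L1 'i%:MP c.
  by have := acts_asC g1 L1 'i; rewrite -mul_mpolyC mulr1.
have act_conic (z : 'rV[{mpoly C[2 + 2]}]_2) (U : 'I_2 -> 'I_2 ->
  {mpoly C[3 + 3]}) i :
    (forall a b, acts_as g1 L1 (z 0 a * z 0 b) (U a b)) ->
    acts_as g1 L1 (conic 'i%:MP z 0 i) (cone_of_squares c U 0 i).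
  move=> act; rewrite !mxE; move: i; elim/forall_ord3 => /=.
  - exact: acts_asB.
  - by apply: acts_asM; [exact: act_c | exact: acts_asD].
  - apply: acts_asM => //; exact: acts_as_nat.
have act_x i : acts_as g1 L1 (conic 'i%:MP (xgen C) 0 i) (u 0 i).
  rewrite -(conic_invK c2 h2 u); apply: act_conic => a b; rewrite !mxE;
    exact: act_xx.
have act_y i : acts_as g1 L1 (conic 'i%:MP (ygen C) 0 i) (v 0 i).
  rewrite -(conic_invK c2 h2 v); apply: act_conic => a b; rewrite !mxE;
    exact: act_yy.
apply: (@acts_as_subst _ _ _ _ g1 L1 _ _ idfun) => [a|k];
  first by rewrite -mul_mpolyC mulr1.
rewrite -(splitK k); case: (split k) => i /=; rewrite ?row_mxEl ?row_mxEr.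
  have -> : 'X_(lshift 3 i) = u 0 i + v 0 i.
    have -> : 'X_(lshift 3 i) = (4 * q) * sg 0 i by rewrite q4 mul1r mxE.
    by rewrite !mxE; ring.
  rewrite [X in acts_as _ _ X]mxE; exact: acts_asD (act_x i) (act_y i).
have -> : 'X_(rshift 3 i) = 2 * (u 0 i - v 0 i).
  have -> : 'X_(rshift 3 i) = (4 * q) * dg 0 i by rewrite q4 mul1r mxE.
  by rewrite !mxE; ring.
rewrite [X in acts_as _ _ X]mxE; apply: (acts_asM (acts_as_nat _ _ 2)).
rewrite [X in acts_as _ _ X]mxE [X in acts_as _ _ (_ + X)]mxE.
exact: acts_asB (act_x i) (act_y i).
Qed.

(** Modulo the annihilator of [slice_lift] the vectors u and v are isotropic,
    so there [double_lift] inverts [xy_pullback]; thus a polynomial killed by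
    [xy_pullback] is in this annihilator. *)
Lemma xy_pullback_eq0 p : xy_pullback p = 0 -> g (slice_lift s D p) = 0.
Proof.
move=> p0; have : K p.
  apply/quot_pi_eq0; rewrite -[RHS](rmorph0 g1);
    apply: acts_as_inj (xy_pullback_acts p) _.
    exact: double_lift1.
  by rewrite p0; apply: acts_as0.
by move=> /(_ 1); rewrite mul1r rmorph0 mulr0.
Qed.

End Relations.

Lemma ideal_half (F : numFieldType) (n : nat) (I : ideal {mpoly F[n]}) b :
  I (b *+ 2) -> I b.
Proof.
move=> Ib; have -> : b = (2^-1)%:MP * (b *+ 2).
  by rewrite mul_mpolyC -scaler_nat scalerA mulVf ?scale1r // pnatr_eq0.
exact: idealM.
Qed.

Section SliceIdealContains.
Variable C : numClosedFieldType.
Local Notation mpM := {mpoly C[(3 + 3) * (3 + 3)]}.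
Variable T : ideal mpM.
Local Notation X := (generic_mx C).
Hypothesis T_slice : forall p : mpM,
  (forall A, slice A -> peval p (mxvec A) = 0) -> T p.
Hypothesis T_tr : T (\tr (X *m X)).
Hypothesis T_pow4 : forall i j, T ((X *m X *m (X *m X)) i j).

Lemma slice_congr_in p q : (forall A, slice A ->
  peval p (mxvec A) = peval q (mxvec A)) ->
  T q -> T p.
Proof.
move=> eq_pq Tq; rewrite -(subrK q p); apply: idealD => //.
by apply: T_slice => A SA; rewrite /peval mevalB [X in X - _]eq_pq // subrr.
Qed.

Lemma eval_generic_mx A : map_mx (meval (mxvec A 0)) X = A.
Proof. by rewrite -map_peval peval_generic_mx mxvecK. Qed.

Lemma eval_slice_mx A : slice A ->
  map_mx (meval (mxvec A 0)) (slice_mx (slice_s X) (slice_D X)) = A.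
Proof.
move=> SA; rewrite map_slice_mx map_slice_s map_slice_D eval_generic_mx
  slice_mxK // => a.
by move/eqP; rewrite mulrn_eq0 => /eqP.
Qed.

(** T contains the equations of the slice, so modulo T the matrix of
    variables is a matrix of the slice. *)
Lemma slice_mx_generic s D : s = slice_s X -> D = slice_D X ->
  [/\ D^T = D, T (\tr (slice_mx s D *m slice_mx s D)),
    (forall i j, T ((slice_mx s D *m slice_mx s D *m (slice_mx s D *m slice_mx s
      D)) i j))
    & forall i j, T (slice_mx s D i j - X i j)].
Proof.
move=> sE DE; have ev A : slice A -> map_mx (meval (mxvec A 0)) (slice_mx s D) =
  A.
  by rewrite sE DE; apply: eval_slice_mx.
have symD : D^T = D by rewrite DE tr_slice_D.
have e (M : 'M[mpM]_(3 + 3)) i j A :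
    (M i j).@[mxvec A 0] = map_mx (meval (mxvec A 0)) M i j by rewrite mxE.
move: {sE DE} (slice_mx s D) ev => M ev.
split=> //.
- apply: slice_congr_in T_tr => A SA; rewrite /peval.
  by rewrite -!trace_map_mx !map_mxM ev // eval_generic_mx.
- move=> i j; apply: slice_congr_in (T_pow4 i j) => A SA; rewrite /peval.
  by rewrite !e !map_mxM ev // eval_generic_mx.
- by move=> i j; apply: T_slice => A SA;
    rewrite /peval mevalB !e ev // eval_generic_mx subrr.
Qed.

(** By the hypotheses on T the coordinates (s, D) satisfy modulo T all
    relations that [slice_lift] needs, so that [slice_lift] inverts
    [sd_pullback] there. *)
Lemma pullback_inj p : xy_pullback (sd_pullback p) = 0 -> T p.
Proof.
move=> p0; pose g := quot_pi T.
have [s sE] : exists s, s = slice_s X by exists (slice_s X).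
have [D DE] : exists D, D = slice_D X by exists (slice_D X).
have [D_sym Mtr Mpow4 MX] := slice_mx_generic sE DE.
have half := @ideal_half _ _ T.
have gD_sym i j : g (D i j) = g (D j i) by rewrite -{1}D_sym mxE.
have gD_exch i j k l : g (D i j) * g (D k l) = g (D i k) * g (D j l).
  rewrite -!rmorphM; apply/quot_piP.
  exact: slice_ideal_exch half D_sym Mtr Mpow4 _ _ _ _.
have gsD j : g (\sum_i s 0 i * D i j) = 0.
  apply/quot_pi_eq0; have := slice_ideal_mul half D_sym Mtr Mpow4 j.
  by rewrite mxE.
have gtr : g (4 * normsq s + \tr D) = 0.
  by apply/quot_pi_eq0; rewrite addrC; exact: slice_ideal_tr half D_sym Mtr.
apply/quot_pi_eq0; rewrite -[RHS](xy_pullback_eq0 gD_sym gD_exch gsD gtr p0).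
have act : acts_as g (slice_lift s D) (sd_pullback p) p.
  apply: (@acts_as_subst _ _ _ _ g (slice_lift s D) _ _ idfun) => [c|k].
    by rewrite -mul_mpolyC mulr1.
  case/mxvec_indexP: k => i j; rewrite mxvecE.
  have act : acts_as g (slice_lift s D) (slice_mx (sgen C) ((dgen C)^T *m dgen
    C) i j)
      (slice_mx s D i j) by exact: slice_lift_entry.
  apply: acts_as_eq act _; apply/quot_piP; have := MX i j;
    rewrite [X in T (_ - X) -> _]mxE mxE; exact.
by have := act 1; rewrite mul1r /= slice_lift1 rmorph1 mul1r.
Qed.

End SliceIdealContains.

(** * The image of the pullback *)

Lemma map_conic_inv (B B' : comNzRingType) (f : {rmorphism B -> B'}) c h u i j :
  f (conic_inv c h u i j) = conic_inv (f c) (f h) (map_mx f u) i j.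
Proof.
by rewrite /conic_inv !mxE; do 2?case: ifP => _;
  rewrite ?(rmorphM, rmorphN, rmorphB, rmorphD).
Qed.

Section Surjectivity.
Variable C : numClosedFieldType.

Lemma sd_pullback_even (p : {mpoly C[3 + 3]}) : exists r :
  {mpoly C[(3 + 3) * (3 + 3)]},
  forall s d, peval r (mxvec (slice_mx s (d^T *m d))) *+ 2 =
    peval p (row_mx s d) + peval p (row_mx s (- d)).
Proof.
have [s sE] : exists s, s = slice_s (generic_mx C)
  by exists (slice_s (generic_mx C)).
have [D DE] : exists D, D = slice_D (generic_mx C)
  by exists (slice_D (generic_mx C)).
exists (slice_lift s D p) => z d.
set A := slice_mx z _.
have es : map_mx (meval (mxvec A 0)) s = z
  by rewrite sE map_slice_s eval_generic_mx slice_sK.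
have eD : map_mx (meval (mxvec A 0)) D = d^T *m d.
  by rewrite DE map_slice_D eval_generic_mx slice_DK // trmx_mul trmxK.
apply: (slice_lift_eval (e := meval (mxvec A 0))) => [c|i|i j].
- by rewrite -mul_mpolyC mulr1; exact: mevalC.
- by rewrite -es mxE.
- by move/matrixP/(_ i j): eD; rewrite !mxE big_ord1 !mxE.
Qed.

Lemma xy_pullback_even (p : {mpoly C[2 + 2]}) : exists r : {mpoly C[3 + 3]},
  forall x y, peval r (sd_of_xy 'i x y) *+ 4 =
    peval p (row_mx x y) + peval p (row_mx (- x) y) +
    peval p (row_mx x (- y)) + peval p (row_mx (- x) (- y)).
Proof.
pose c : {mpoly C[3 + 3]} := 'i%:MP; pose h : {mpoly C[3 + 3]} := (2^-1)%:MP.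
pose q : {mpoly C[3 + 3]} := (4^-1)%:MP.
pose u := q *: (2 *: sgen C + dgen C); pose v := q *: (2 *: sgen C - dgen C).
exists (double_lift (conic_inv c h u) (conic_inv c h v) p) => x y.
pose e : {rmorphism {mpoly C[3 + 3]} -> C} := meval (sd_of_xy 'i x y 0).
have e_c : e c = 'i by exact: mevalC.
have e_h : e h = 2^-1 by exact: mevalC.
have e_q : e q = 4^-1 by exact: mevalC.
have es i : e (sgen C 0 i) = conic 'i x 0 i + conic 'i y 0 i.
  rewrite mxE; transitivity (sd_of_xy 'i x y 0 (lshift 3 i));
    first exact: mevalXU.
  by rewrite row_mxEl mxE.
have ed i : e (dgen C 0 i) = 2 * (conic 'i x 0 i - conic 'i y 0 i).
  rewrite mxE; transitivity (sd_of_xy 'i x y 0 (rshift 3 i));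
    first exact: mevalXU.
  by rewrite row_mxEr mxE [X in _ * X]mxE [X in _ * (_ + X)]mxE.
have e2 : e 2 = 2 by exact: rmorph_nat.
have eu : map_mx e u = conic 'i x.
  apply/rowP => i; rewrite mxE /u mxE mxE [X in e (_ * (X + _))]mxE.
  by rewrite rmorphM rmorphD rmorphM e_q e2 es ed; field.
have ev : map_mx e v = conic 'i y.
  apply/rowP => i; rewrite mxE /v mxE mxE [X in e (_ * (X + _))]mxE [X in e (_ *
    (_ + X))]mxE.
  by rewrite rmorphM rmorphD rmorphM rmorphN e_q e2 es ed; field.
have c2 : 'i ^+ 2 = -1 :> C by rewrite sqrCi.
have h2 : 2 * 2^-1 = 1 :> C by rewrite mulfV // pnatr_eq0.
apply: (double_lift_eval (e := e)) => [a|i j|i j].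
- by rewrite -mul_mpolyC mulr1; exact: mevalC.
- by rewrite map_conic_inv e_c e_h eu conicK.
- by rewrite map_conic_inv e_c e_h ev conicK.
Qed.

End Surjectivity.

Lemma mpoly_eq_row (F : numDomainType) n k (p q : {mpoly F[n + k]}) :
  (forall x y, peval p (row_mx x y) = peval q (row_mx x y)) -> p = q.
Proof.
move=> eq_pq; apply/eqP; rewrite -subr_eq0; apply/eqP/mpoly_eq0_forall => v.
rewrite -(@meval_eq _ _ ((\row_i v i : 'rV[F]_(n + k)) 0)) => [|i];
  last by rewrite mxE.
rewrite -[\row_i _]hsubmxK mevalB; apply/eqP; rewrite subr_eq0; apply/eqP/eq_pq.
Qed.

Section WreathModel.
Variable C : numClosedFieldType.
Implicit Types (x y : 'rV[C]_2).
Local Notation mpM := {mpoly C[(3 + 3) * (3 + 3)]}.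

Lemma conicN (B : comNzRingType) (c : B) (z : 'rV[B]_2) :
  conic c (- z) = conic c z.
Proof. by apply/rowP; elim/forall_ord3; rewrite !mxE /= ?mxE; ring. Qed.

Lemma wreath_mxN x y : wreath_mx (- x) y = wreath_mx x y.
Proof. by rewrite /wreath_mx conicN. Qed.

Lemma wreath_mxC x y : wreath_mx y x = wreath_mx x y.
Proof.
rewrite /wreath_mx addrC -[conic 'i y - _]opprB scalerN; congr slice_mx.
by rewrite [(- _)^T]linearN /= mulNmx mulmxN opprK.
Qed.

Lemma wreath_mx_slice x y : slice (wreath_mx x y).
Proof. by apply: slice_mx_slice; rewrite trmx_mul trmxK. Qed.

Lemma wreath_mx_subregular x y : normsq (conic 'i x + conic 'i y) != 0 ->
  subregular (wreath_mx x y).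
Proof.
have c2 : 'i ^+ 2 = -1 :> C by rewrite sqrCi.
have := conic_normsq c2 x; have := conic_normsq c2 y.
rewrite /wreath_mx; move: (conic 'i x) (conic 'i y) => u v.
rewrite /normsq !sum_ord3 => v0 u0 s0.
apply: slice_mx_subregular; last by rewrite /normsq sum_ord3.
  rewrite /normsq !sum_ord3 !mxE.
  transitivity (8 * (u 0 i0 ^+ 2 + u 0 i1 ^+ 2 + u 0 i2 ^+ 2) +
    8 * (v 0 i0 ^+ 2 + v 0 i1 ^+ 2 + v 0 i2 ^+ 2)); first by ring.
  by rewrite u0 v0; ring.
apply/rowP => k; rewrite ord1 mxE sum_ord3 !mxE.
transitivity (2 * (u 0 i0 ^+ 2 + u 0 i1 ^+ 2 + u 0 i2 ^+ 2) -
    2 * (v 0 i0 ^+ 2 + v 0 i1 ^+ 2 + v 0 i2 ^+ 2)); first by ring.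
by rewrite u0 v0; ring.
Qed.

Definition wreath_pullback (p : mpM) : {mpoly C[2 + 2]} :=
  xy_pullback (sd_pullback p).

HB.instance Definition _ := GRing.RMorphism.copy wreath_pullback
  (@xy_pullback C \o @sd_pullback C).

Lemma wreath_pullbackZ : scalable wreath_pullback.
Proof. by move=> a p; rewrite /wreath_pullback /sd_pullback /xy_pullback
  !substZ. Qed.

Lemma wreath_pullback_eq0 p : (forall x y,
  peval p (mxvec (wreath_mx x y)) = 0) ->
  wreath_pullback p = 0.
Proof.
move=> p0; apply: mpoly_eq_row => x y.
by rewrite peval_wreath p0 /peval meval0.
Qed.

(** Where the polynomial N, the value of [s.s], does not vanish, [wreath_mx]
    takes values in the orbit. So the product of N with the pullback of p is
    zero at every point, and N can be cancelled. *)
Lemma wreath_pullback_orbit0 (x : 'M[C]_(3 + 3)) p : subregular x ->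
  (forall A, Sp_orbit x A -> peval p (mxvec A) = 0) -> wreath_pullback p = 0.
Proof.
move=> xsub p0.
pose N : {mpoly C[2 + 2]} := xy_pullback (normsq (sgen C)).
have NE y z : peval N (row_mx y z) = normsq (conic 'i y + conic 'i z).
  rewrite peval_xy /normsq /peval raddf_sum; apply: eq_bigr => i _.
  rewrite [LHS](rmorphXn (meval _)) mxE; congr (_ ^+ _).
  by rewrite [LHS]mevalXU row_mxEl.
have N0 : N != 0.
  apply/eqP => N0; have := NE (delta_mx 0 j0) (delta_mx 0 j1).
  rewrite N0 /peval meval0 /normsq sum_ord3 !mxE /= => /eqP.
  rewrite !(mulr0, mulr1, mul0r, addr0, add0r, sub0r, subr0, subrr, expr0n) /=.
  by rewrite -mulr2n -mulr_natl exprMn sqrCi mulrN1 eq_sym oppr_eq0 sqrf_eq0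
    pnatr_eq0.
apply/eqP; rewrite -[_ == 0](inj_eq (mulfI N0)) mulr0;
  apply/eqP/mpoly_eq_row => y z.
rewrite {1}/peval mevalM -/(peval N (row_mx y z)) -/(peval _ (row_mx y z)) NE.
rewrite [in RHS]/peval meval0 peval_wreath.
have [->|yz] := eqVneq (normsq (conic 'i y + conic 'i z)) 0; first
  by rewrite mul0r.
rewrite p0 ?mulr0 //; exact/subregular_orbit/wreath_mx_subregular.
Qed.

Lemma wreath_pullback_invariant p : wreath_pullback p \in Defs.invariant
  (wreath_group C).
Proof.
apply/invariantP => h Hh v.
have inv g : wreath_group C g -> forall v,
  peval (wreath_pullback p) (v *m g) = peval (wreath_pullback p) v.
  elim=> {g} [g|w|g1 g2 _ IH1 _ IH2 w|g _ IH w].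
  - case=> -> w; rewrite -[w]hsubmxK /wreath_pullback.
      by rewrite sigmaE !peval_wreath wreath_mxC.
    by rewrite tauE !peval_wreath wreath_mxN.
  - by rewrite mulmx1.
  - by rewrite mulmxA IH2 IH1.
  - have [gu|gNu] := boolP (g \in unitmx); first by rewrite -IH mulmxKV.
    by rewrite (invmx_out gNu) IH.
exact: inv.
Qed.

(** Lifting h to (s, d) averages over four changes of signs, lifting the
    result to (s, D) averages over the exchange of x and y; an invariant
    polynomial is its own average. *)
Lemma wreath_pullback_surj (h : {mpoly C[2 + 2]}) :
  h \in Defs.invariant (wreath_group C) ->
  exists p, wreath_pullback p = h.
Proof.
move=> /invariantP h_inv.
have h_tau x y : peval h (row_mx (- x) y) = peval h (row_mx x y).
  by rewrite -tauE h_inv //; apply: Gen_in; right.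
have h_sigma x y : peval h (row_mx y x) = peval h (row_mx x y).
  by rewrite -sigmaE h_inv //; apply: Gen_in; left.
have h_tau' x y : peval h (row_mx x (- y)) = peval h (row_mx x y).
  by rewrite -h_sigma h_tau h_sigma.
have [q qE] := xy_pullback_even h; have [p pE] := sd_pullback_even q.
exists p; apply: mpoly_eq_row => x y; rewrite peval_wreath.
have eight : (8 : C) != 0 by rewrite pnatr_eq0.
apply: (mulfI eight); rewrite !mulr_natl.
have pE' := pE (conic 'i x + conic 'i y) (2 *: (conic 'i x - conic 'i y)).
have qE1 := qE x y; have qE2 := qE y x.
rewrite -[8%N]/(2 * 4)%N mulrnA pE' mulrnDl -[X in X + _]/(peval q (sd_of_xy 'i
  x y) *+ 4).
have -> : row_mx (conic 'i x + conic 'i y) (- (2 *: (conic 'i x - conic 'i y)))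
  =
    sd_of_xy 'i y x.
  by rewrite /sd_of_xy addrC -[in RHS]opprB scalerN.
by rewrite qE1 qE2 !(h_tau, h_tau') (h_sigma x y); ring.
Qed.

End WreathModel.

(** * The isomorphism *)

Section InvariantVal.
Variables (F : comNzRingType) (n : nat) (H : set 'M[F]_n).
Implicit Types u v : invariant_alg H.

Lemma invariant_valB u v : \val (u - v) = \val u - \val v.
Proof. exact: rmorphB. Qed.

Lemma invariant_val1 : \val (1 : invariant_alg H) = 1.
Proof. exact: rmorph1. Qed.

Lemma invariant_valM u v : \val (u * v) = \val u * \val v.
Proof. exact: rmorphM. Qed.

Lemma invariant_valZ c u : \val (c *: u) = c *: \val u.
Proof. exact: linearZ. Qed.

End InvariantVal.

Section SliceOrbit.
Variables (C : numClosedFieldType) (x : 'M[C]_(3 + 3)).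
Hypothesis x_sub : subregular x.
Let T := ideal_sum (vanishing_ideal (mxvec @` slice))
                   (vanishing_ideal (zariski_closure (mxvec @` Sp_orbit x))).

Lemma slice_vanishing_in p : (forall A, slice A -> peval p (mxvec A) = 0) ->
  T p.
Proof.
move=> p0; exists p; first by move=> _ [A SA <-]; apply: p0.
by exists 0; [exact: ideal0 | rewrite addr0].
Qed.

Lemma orbit_vanishing_in p : (forall A, Sp_orbit x A ->
  peval p (mxvec A) = 0) -> T p.
Proof.
move=> p0; exists 0; first exact: ideal0.
exists p; last by rewrite add0r.
by move=> v cl_v; apply: (cl_v p) => /= _ [A OA <-]; apply: p0.
Qed.

Lemma orbit_pow4 A : Sp_orbit x A -> A *m A *m (A *m A) = 0.
Proof.
move=> [g Spg <-]; have gu := Sp_unit Spg; have [_ x4 _ _] := x_sub.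
by rewrite !mulmxA !mulmxKV // -[g *m x *m x]mulmxA -[g *m _ *m x]mulmxA
  -[g *m _ *m x]mulmxA -[x *m x *m x *m x]mulmxA x4 mulmx0 mul0mx.
Qed.

(** The normal form has square of trace zero. *)
Lemma orbit_tr A : Sp_orbit x A -> \tr (A *m A) = 0.
Proof.
move=> [g Spg <-]; have gu := Sp_unit Spg;
  have [h Sph xh] := subregular_nfP x_sub.
rewrite !mulmxA mulmxKV // mxtrace_mulC !mulmxA mulVmx // mul1mx.
have -> : x = h *m subregular_nf C *m invmx h by rewrite -xh mulmxK // Sp_unit.
rewrite !mulmxA mulmxKV ?(Sp_unit Sph) // mxtrace_mulC !mulmxA mulVmx ?(Sp_unit
  Sph) // mul1mx.
rewrite /subregular_nf mulmx_block mul0mx addr0 mxtrace_block mulmx0 add0r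
  mulmxN mulNmx opprK.
by rewrite !mul_delta_mx_0 // !mxtrace0 addr0.
Qed.

(** Vanishing on the closure implies vanishing on the orbit, which is enough
    for the second summand. *)
Lemma wreath_pullback_ker p : T p -> wreath_pullback p = 0.
Proof.
move=> [a Ia [b Ib ->]]; rewrite rmorphD /= wreath_pullback_eq0 => [|y z];
  last first.
  by apply: Ia; exists (wreath_mx y z) => //; apply: wreath_mx_slice.
rewrite (wreath_pullback_orbit0 x_sub) ?addr0 // => A OA.
by apply: Ib => q; apply; exists A.
Qed.

Lemma wreath_pullback_eq0_in p : wreath_pullback p = 0 -> T p.
Proof.
apply: pullback_inj; first exact: slice_vanishing_in.
  apply: orbit_vanishing_in => A OA; rewrite -(orbit_tr OA) -{2
    3}(eval_generic_mx A).
  by rewrite -map_mxM trace_map_mx.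
move=> i j; apply: orbit_vanishing_in => A OA;
  move/matrixP/(_ i j): (orbit_pow4 OA).
by rewrite -{1 2 3 4}(eval_generic_mx A) -!map_mxM !mxE.
Qed.

Definition slice_to_wreath (u : quot_alg T) : invariant_alg (wreath_group C) :=
  InvariantAlg (wreath_pullback_invariant (repr u)).

Arguments slice_to_wreath : simpl never.

Lemma slice_to_wreathE p :
  \val (slice_to_wreath (quot_pi T p)) = wreath_pullback p.
Proof.
rewrite -[LHS]/(wreath_pullback (repr (quot_pi T p))).
by apply/eqP; rewrite -subr_eq0 -rmorphB;
  apply/eqP/wreath_pullback_ker/quot_repr.
Qed.

Lemma quot_pi_surj u : exists p, u = quot_pi T p.
Proof. by exists (repr u); rewrite quot_piK. Qed.

Lemma slice_to_wreath_zmod : zmod_morphism slice_to_wreath.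
Proof.
move=> u v; have [p ->] := quot_pi_surj u; have [q ->] := quot_pi_surj v.
rewrite -rmorphB; apply/val_inj.
by rewrite invariant_valB !slice_to_wreathE rmorphB.
Qed.

Lemma slice_to_wreath_monoid : monoid_morphism slice_to_wreath.
Proof.
split=> [|u v]; apply/val_inj.
  by rewrite invariant_val1 -(rmorph1 (quot_pi T)) slice_to_wreathE rmorph1.
have [p ->] := quot_pi_surj u; have [q ->] := quot_pi_surj v.
by rewrite invariant_valM -rmorphM !slice_to_wreathE rmorphM.
Qed.

Lemma slice_to_wreath_scalable : scalable slice_to_wreath.
Proof.
move=> c u; have [p ->] := quot_pi_surj u; apply/val_inj.
by rewrite invariant_valZ -[c *: quot_pi T p]quot_piZ !slice_to_wreathE
  wreath_pullbackZ.
Qed.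

Lemma slice_to_wreath_bij : bijective slice_to_wreath.
Proof.
have inj : injective slice_to_wreath.
  move=> u v uv; apply/eqP; rewrite -subr_eq0; apply/eqP.
  have: slice_to_wreath (u - v) = 0 by rewrite slice_to_wreath_zmod uv subrr.
  have [p ->] := quot_pi_surj (u - v) => /(congr1 \val).
  by rewrite slice_to_wreathE => /wreath_pullback_eq0_in Tp; apply/quot_pi_eq0.
have surj y : exists u, slice_to_wreath u = y.
  have [p pE] := wreath_pullback_surj (invariant_valP y).
  by exists (quot_pi T p); apply/val_inj; rewrite slice_to_wreathE.
have [h hK] := choice surj.
by exists h => // u; apply: inj; rewrite hK.
Qed.

Lemma slice_wreath_iso :
  exists f : {rmorphism quot_alg T -> invariant_alg (wreath_group C)},
    scalable f /\ bijective f.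
Proof.
pose zM := GRing.isZmodMorphism.Build _ _ slice_to_wreath slice_to_wreath_zmod.
pose mM := GRing.isMonoidMorphism.Build _ _ slice_to_wreath
  slice_to_wreath_monoid.
pose f : {rmorphism quot_alg T -> invariant_alg (wreath_group C)} :=
  HB.pack slice_to_wreath zM mM.
by exists f; split; [exact: slice_to_wreath_scalable | exact:
  slice_to_wreath_bij].
Qed.

End SliceOrbit.

Local Open Scope complex_scope.

Theorem proposition1 (R : realType) (x : 'M[R[i]]_(3 + 3))
    (x_sp : sp x) (x_type : nilpotent_type [:: 4; 2]%N x) :
  let O42 := Sp_orbit x in
  let T := ideal_sum (vanishing_ideal (mxvec @` slice))
                     (vanishing_ideal (zariski_closure (mxvec @` O42))) in
  exists f : {rmorphism quot_alg T -> invariant_alg (wreath_group R[i])},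
    scalable f /\ bijective f.
Proof.
exact: slice_wreath_iso (nilpotent_type42_subregular x_sp x_type).
Qed.
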